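(* Consider the one-way random effects model $Y_{ij}=\mu+b_i+e_{ij}$, $i=1,\ldots,k$, $j=1,\ldots,n_i$, with $\mathbb{E}[e_{ij}^4]<\infty$, and let $J_n=\binom{n}{2}B_n/(W_n\sqrt{M_n})$, where $n=\sum_{i=1}^k n_i$. Suppose that the null hypothesis $\sigma_b^2=0$ holds and that the treatment sizes are bounded, i.e. there is a constant $N$ with $2\le n_i\le N$ for all $i$ and all $k$. Then, as $k\to\infty$ (so that $n\to\infty$), $$J_n=\frac{\binom{n}{2}B_n}{W_n\sqrt{M_n}}\xrightarrow{D}\mathcal{N}(0,1).$$
   Context: Model: $Y_{ij}=\mu+b_i+e_{ij}$ for $i=1,\ldots,k$, $j=1,\ldots,n_i$ with $n_i\ge 2$, where $\mu\in\mathbb{R}$, all the random variables $b_i$ and $e_{ij}$ are mutually independent, the $b_i$ are identically distributed with mean $0$ and variance $\sigma_b^2\ge 0$, and the $e_{ij}$ are identically distributed with mean $0$ and variance $\sigma_e^2>0$. Put $n=\sum_{i=1}^k n_i$. Define the within-treatment $U$-statistics $$U_i=\binom{n_i}{2}^{-1}\sum_{1\le j<j'\le n_i}\frac{(Y_{ij}-Y_{ij'})^2}{2},\quad i=1,\ldots,k,$$ and the between-treatment generalized $U$-statistics $$U_{ii'}=(n_in_{i'})^{-1}\sum_{j=1}^{n_i}\sum_{j'=1}^{n_{i'}}\frac{(Y_{ij}-Y_{i'j'})^2}{2},\quad 1\le i<i'\le k.$$ Set $$W_n=\sum_{i=1}^k\frac{n_i}{n}U_i,\qquad B_n=\sum_{1\le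 i<i'\le k}\frac{n_in_{i'}}{n(n-1)}\{2U_{ii'}-U_i-U_{i'}\}.$$ List the observations lexicographically as $Y_1,\ldots,Y_n$ (the first $n_1$ from treatment 1, the next $n_2$ from treatment 2, and so on). For $1\le r\neq s\le n$ define the weights $\eta_{nrs}=(n-n_i)/(n_i-1)$ if $Y_r$ and $Y_s$ are both observed under the $i$-th treatment, and $\eta_{nrs}=-1$ otherwise. Set $M_n=\sum_{1\le r<s\le n}\eta_{nrs}^2$. The symbol $\xrightarrow{D}$ denotes convergence in distribution. *)

(* Defs.v *)
From HB Require Import structures.
From mathcomp Require Import all_boot all_order all_algebra.
From mathcomp Require Import all_classical all_reals all_analysis.
From mathcomp Require Import measurable_realfun.

Set Implicit Arguments.
Unset Strict Implicit.
Unset Printing Implicit Defensive.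

Import Order.TTheory GRing.Theory Num.Theory.
Import numFieldNormedType.Exports.

Local Open Scope classical_set_scope.
Local Open Scope ring_scope.

Definition mutually_independent d (T : measurableType d) (R : realType)
    (P : probability T R) (I : finType) (X : I -> {RV P >-> R}) : Prop :=
  forall (J : {set I}) (A : I -> set R), (forall i, measurable (A i)) ->
    P (\bigcap_(i in [set` J]) X i @^-1` A i)
      = (\prod_(i in J) P (X i @^-1` A i))%E.

(* The two variables may live on different probability spaces. *)
Definition identically_distributed d d' (T : measurableType d)
    (T' : measurableType d') (R : realType) (P : probability T R)
    (P' : probability T' R) (X : {RV P >-> R}) (X' : {RV P' >-> R}) : Prop :=
  forall A : set R, measurable A -> distribution P X A = distribution P' X' A.

Definition converges_in_distribution (R : realType) (d : nat -> measure_display)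
    (T : forall k, measurableType (d k)) (P : forall k, probability (T k) R)
    (X : forall k, {RV (P k) >-> R})
    (Q : probability (measurableTypeR R) R) : Prop :=
  forall x : R, {for x, continuous (fun y : R => Q `]-oo, y]%classic)} ->
    (fun k => cdf (X k) x) @ \oo --> Q `]-oo, x]%classic.

(* Statistics, as functions of the data y i j of an unbalanced one-way layout
   with k treatments of sizes n i. *)
Section statistics.
Context {R : realType} {k : nat} (n : 'I_k -> nat).
Implicit Type y : forall i : 'I_k, 'I_(n i) -> R.

Definition total_size : nat := (\sum_(i < k) n i)%N.

Local Notation N := (total_size%:R : R).

Definition Uwithin y (i : 'I_k) : R :=
  ('C(n i, 2)%:R)^-1 *
  \sum_(j < n i) \sum_(j' < n i | (j < j')%N) (y i j - y i j') ^+ 2 / 2.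

Definition Ubetween y (i i' : 'I_k) : R :=
  ((n i)%:R * (n i')%:R)^-1 *
  \sum_(j < n i) \sum_(j' < n i') (y i j - y i' j') ^+ 2 / 2.

Definition Wstat y : R := \sum_(i < k) (n i)%:R / N * Uwithin y i.

Definition Bstat y : R :=
  \sum_(i < k) \sum_(i' < k | (i < i')%N)
    (n i)%:R * (n i')%:R / (N * (N - 1)) *
    (2 * Ubetween y i i' - Uwithin y i - Uwithin y i').

(* [tagnat.sig1 r] is the treatment of the r-th observation when the pooled
   sample is listed treatment after treatment. *)
Definition eta (r s : 'I_(\sum_(i < k) n i)) : R :=
  if tagnat.sig1 r == tagnat.sig1 s then
    (N - (n (tagnat.sig1 r))%:R) / ((n (tagnat.sig1 r))%:R - 1)
  else -1.

Definition Mconst : R :=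
  \sum_(r < \sum_(i < k) n i) \sum_(s < \sum_(i < k) n i | (r < s)%N)
    eta r s ^+ 2.

Definition Jstat y : R :=
  'C(total_size, 2)%:R * Bstat y / (Wstat y * Num.sqrt Mconst).

End statistics.

Lemma measurable_inv (R : realType) : measurable_fun setT (@GRing.inv R).
Proof.
rewrite -(setvU [set (0 : R)]); apply/measurable_funU => //.
  exact: measurableC.
split; last exact: measurable_fun_set1.
apply: open_continuous_measurable_fun; first exact/closed_openC/closed_eq.
by move=> x; rewrite inE/= => /eqP x0; exact: inv_continuous.
Qed.

Lemma measurable_sum_cond d (T : measurableType d) (R : realType) (I : Type)
    (r : seq I) (Q : pred I) (h : I -> T -> R) :
  (forall i, measurable_fun setT (h i)) ->
  measurable_fun setT (fun w => \sum_(i <- r | Q i) h i w).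
Proof.
by move=> mh; under eq_fun do rewrite -big_filter; exact: measurable_sum.
Qed.

Section model.
Context d (T : measurableType d) (R : realType) (P : probability T R).
Context (k : nat) (n : 'I_k -> nat).
Variables (mu : R) (b : 'I_k -> {RV P >-> R})
  (e : forall i : 'I_k, 'I_(n i) -> {RV P >-> R}).

Definition effects_and_errors (u : 'I_k + {i : 'I_k & 'I_(n i)}) :
    {RV P >-> R} :=
  match u with
  | inl i => b i
  | inr p => e (tagged p)
  end.

(* The constraints on the random variables in Y_ij = mu + b_i + e_ij, where
   sb2 and se2 are the variances of the effects and of the errors.  The
   expectation of a non-integrable function is infinite in the library, so the
   mean and variance equations contain the integrability of b_i, e_ij and of
   their squares. *)
Record random_effects_model (sb2 se2 : R) : Prop := RandomEffectsModel {
  model_size : forall i, (2 <= n i)%N ;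
  model_sb2 : 0 <= sb2 ;
  model_se2 : 0 < se2 ;
  model_indep : mutually_independent effects_and_errors ;
  model_b_ident : forall i i', identically_distributed (b i) (b i') ;
  model_b_mean : forall i, ('E_P[b i] = 0)%E ;
  model_b_var : forall i, ('V_P[b i] = sb2%:E)%E ;
  model_e_ident : forall i j i' j',
    identically_distributed (@e i j) (@e i' j') ;
  model_e_mean : forall i j, ('E_P[@e i j] = 0)%E ;
  model_e_var : forall i j, ('V_P[@e i j] = se2%:E)%E
}.

Definition response (i : 'I_k) (j : 'I_(n i)) (w : T) : R :=
  mu + b i w + e j w.

Lemma measurable_response i j : measurable_fun setT (@response i j).
Proof.
apply: measurable_funD; last exact: measurable_funPT.
by apply: measurable_funD; [exact: measurable_cst|exact: measurable_funPT].
Qed.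

Definition Jresponse (w : T) : R := Jstat (fun i j => @response i j w).

Let measurable_sqdiff i j i' j' :
  measurable_fun setT
    (fun w => (@response i j w - @response i' j' w) ^+ 2 / 2).
Proof.
apply: measurable_funM; last exact: measurable_cst.
by apply: measurable_funX; apply: measurable_funB; exact: measurable_response.
Qed.

Let measurable_Uwithin i :
  measurable_fun setT (fun w => Uwithin (fun i j => @response i j w) i).
Proof.
apply: measurable_funM; first exact: measurable_cst.
by do 2![apply: measurable_sum_cond => ?]; exact: measurable_sqdiff.
Qed.

Let measurable_Ubetween i i' :
  measurable_fun setT (fun w => Ubetween (fun i j => @response i j w) i i').
Proof.
apply: measurable_funM; first exact: measurable_cst.
by do 2![apply: measurable_sum_cond => ?]; exact: measurable_sqdiff.
Qed.

Lemma measurable_Jresponse : measurable_fun setT Jresponse.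
Proof.
apply: measurable_funM.
  apply: measurable_funM; first exact: measurable_cst.
  apply: measurable_sum_cond => i; apply: measurable_sum_cond => i'.
  apply: measurable_funM; first exact: measurable_cst.
  apply: measurable_funB; last exact: measurable_Uwithin.
  apply: measurable_funB; last exact: measurable_Uwithin.
  by apply: measurable_funM; [exact: measurable_cst|exact: measurable_Ubetween].
apply: (measurableT_comp (@measurable_inv R)).
apply: measurable_funM; last exact: measurable_cst.
apply: measurable_sum_cond => i.
apply: measurable_funM; first exact: measurable_cst.
exact: measurable_Uwithin.
Qed.

HB.instance Definition _ := isMeasurableFun.Build _ _ _ _ Jresponse
  measurable_Jresponse.

Definition Jn : {RV P >-> R} := Jresponse.

End model.

(* Main.v *)
Require Import Defs.
From mathcomp Require Import all_boot all_order all_algebra.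
From mathcomp Require Import all_classical all_reals all_analysis.
From mathcomp Require Import measurable_realfun ring lra.

Set Implicit Arguments.
Unset Strict Implicit.
Unset Printing Implicit Defensive.

Import Order.TTheory GRing.Theory Num.Theory.
Import numFieldNormedType.Exports.

Local Open Scope classical_set_scope.
Local Open Scope ring_scope.

(** Why the theorem is true.  Under the null hypothesis the treatment effects
    vanish almost surely, so that the statistic is a function of the errors
    e_ij alone.  Let s be their variance, n the total size, S_i the sum of the
    errors of treatment i, and
      Z_i = (n_i - 1)^-1 * (sum of e_ij * e_ij' over j < j').
    Elementary algebra ([WstatE], [BstatE], [MconstE]) gives
      n * W = sum of the e_ij ^ 2 - 2 * (sum of the Z_i),
      'C(n, 2) * B = n * (sum of the Z_i) + D,
      D = - sum of the n_i * Z_i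
          - ((sum of the S_i) ^ 2 - sum of the S_i ^ 2) / 2,
      |M - n ^ 2 * v| <= 3 * n ^ 2,
    where v, the sum of the n_i / (2 * (n_i - 1)), lies between k / 2 and k.
    When W > 0, the inequality J <= x is therefore equivalent to
      (sum of the Z_i) / (s * sqrt v) + r <= x * a,
    where r = D / (n * s * sqrt v) and a = W / s * sqrt (M / (n ^ 2 * v)).
    As the Z_i are independent and centred with total variance s ^ 2 * v,
    and D has mean absolute value O(n), r tends to 0 and a tends to 1 in
    probability ([remainder_mean], [Wstat_moments], [Mconst_near]); this is
    Slutsky's step ([bad_event_le], [bad_event_sandwich]).

    There remains the central limit theorem for the independent variables
    X_i = Z_i / (s * sqrt v), whose fourth moments are controlled because the
    treatment sizes are bounded and a product e_ij * e_ij' of two distinct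
    errors has the square of the fourth moment of an error as fourth moment.
    It is proved by Lindeberg's replacement method, without auxiliary Gaussian
    variables and without characteristic functions.  The function
    Phi ((x0 - x) / sqrt (a + t)), with Phi the normal distribution function,
    solves the heat equation in (t, x): adding X_i to the partial sum, or
    adding the variance of X_i to the time, changes its mean by the same
    amount up to third order ([lindeberg_step]).  Telescoping compares the mean
    of Phi ((x0 - X) / sqrt a), X being the sum of the X_i, with the number
    Phi (x0 / sqrt (a + 1)) ([lindeberg]).  For small a the former is a
    smoothed probability of X <= x0, which gives the convergence of the
    distribution functions ([cvg_cdf_of_heat]).

    Both the method and the moment computations need the independence of
    functions of disjoint groups of errors; it follows from the product rule by
    the uniqueness of measures on pi-systems ([sigma_cylinders_indep]). *)

(** * Integration of real functions against a probability *)

Section integ.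
Context d (T : measurableType d) (R : realType) (P : probability T R).
Implicit Types (f g : T -> R) (A : set T) (x : R).

(** Integrability of a real-valued function. *)
Definition integ f := P.-integrable setT (EFin \o f).

Lemma integ_meas f : integ f -> measurable_fun setT f.
Proof. by move=> /integrableP[/measurable_EFinP]. Qed.

Lemma integ_le f g : measurable_fun setT f -> integ g ->
  (forall w, `|f w| <= g w) -> integ f.
Proof.
move=> mf ig fg; apply: (le_integrable measurableT _ _ ig).
  exact/measurable_EFinP.
by move=> w _ /=; rewrite lee_fin (le_trans (fg w))// ler_norm.
Qed.

Lemma integ_cst c : integ (fun=> c).
Proof. exact: finite_measure_integrable_cst. Qed.

Lemma integD f g : integ f -> integ g -> integ (fun w => f w + g w).
Proof. by move=> F G; exact: (integrableD measurableT F G). Qed.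

Lemma integB f g : integ f -> integ g -> integ (fun w => f w - g w).
Proof. by move=> F G; exact: (integrableB measurableT F G). Qed.

Lemma integZ c f : integ f -> integ (fun w => c * f w).
Proof. by move=> F; exact: (integrableZl measurableT c F). Qed.

Lemma integ_abs f : integ f -> integ (fun w => `|f w|).
Proof. exact: integrable_norm. Qed.

Lemma integ_sum (I : Type) (s : seq I) (Q : pred I) (f : I -> T -> R) :
  (forall i, Q i -> integ (f i)) -> integ (fun w => \sum_(i <- s | Q i) f i w).
Proof.
move=> F; rewrite /integ (_ : _ \o _ =
    fun w => (\sum_(i <- s | Q i) (f i w)%:E)%E).
  exact: integrable_sum.
by apply/funext => w /=; rewrite sumEFin.
Qed.

Lemma integ_bounded f C : measurable_fun setT f -> (forall w, `|f w| <= C) ->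
  integ f.
Proof. by move=> mf fC; apply: (integ_le mf (integ_cst C)). Qed.

Lemma mean_cst c : \int[P]_w (fun=> c : R) w = c.
Proof.
rewrite Rintegral_cst// [X in fine X](_ : _ = 1%E) ?mulr1//.
exact: probability_setT.
Qed.

Lemma meanD f g : integ f -> integ g ->
  \int[P]_w (f w + g w) = \int[P]_w f w + \int[P]_w g w.
Proof. exact: RintegralD. Qed.

Lemma meanB f g : integ f -> integ g ->
  \int[P]_w (f w - g w) = \int[P]_w f w - \int[P]_w g w.
Proof. exact: RintegralB. Qed.

Lemma meanZ c f : integ f -> \int[P]_w (c * f w) = c * \int[P]_w f w.
Proof. exact: RintegralZl. Qed.

Lemma mean_le f g : integ f -> integ g -> (forall w, f w <= g w) ->
  \int[P]_w f w <= \int[P]_w g w.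
Proof. by move=> F G fg; apply: le_Rintegral. Qed.

Lemma mean_abs f : integ f -> `|\int[P]_w f w| <= \int[P]_w `|f w|.
Proof. exact: le_normr_Rintegral. Qed.

Lemma mean_sum (I : Type) (s : seq I) (Q : pred I) (f : I -> T -> R) :
  (forall i, Q i -> integ (f i)) ->
  \int[P]_w (\sum_(i <- s | Q i) f i w) = \sum_(i <- s | Q i) \int[P]_w f i w.
Proof.
move=> F; elim: s => [|i s IH].
  by under eq_Rintegral do rewrite big_nil; rewrite mean_cst big_nil.
rewrite big_cons -IH; under eq_Rintegral do rewrite big_cons.
case: ifP => // Qi; rewrite meanD//; [exact: F|exact: integ_sum].
Qed.

Lemma EFin_mean f : integ f -> (\int[P]_w (f w)%:E)%E = (\int[P]_w f w)%:E.
Proof. by move=> F; rewrite fineK//; exact: integrable_fin_num. Qed.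

Lemma measurable_le f x : measurable_fun setT f ->
  measurable [set w | f w <= x].
Proof.
move=> mf; rewrite (_ : mkset _ = f @^-1` `]-oo, x]); last first.
  by apply/funext => w /=; rewrite in_itv.
by rewrite -[X in measurable X]setTI; exact: mf.
Qed.

Lemma measurable_ge f x : measurable_fun setT f ->
  measurable [set w | x <= f w].
Proof.
move=> mf; rewrite (_ : mkset _ = f @^-1` `[x, +oo[); last first.
  by apply/funext => w /=; rewrite in_itv/= andbT.
by rewrite -[X in measurable X]setTI; exact: mf.
Qed.

Lemma measurable_neq0 f : measurable_fun setT f ->
  measurable [set w | f w != 0].
Proof.
move=> mf; rewrite (_ : mkset _ = f @^-1` (~` [set 0])).
  rewrite -[X in measurable X]setTI; apply: mf => //.
  exact: measurableC.
by apply/seteqP; split => w /= /eqP.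
Qed.

Lemma mean_indic A : measurable A -> \int[P]_w (\1_A w) = fine (P A).
Proof. by move=> mA; rewrite /Rintegral integral_indic// setIT. Qed.

Lemma integ_indic A : measurable A -> integ (\1_A).
Proof. by move=> mA; apply: integrable_indic. Qed.

Lemma markov_mean f c : 0 < c -> (forall w, 0 <= f w) -> integ f ->
  fine (P [set w | c <= f w]) <= (\int[P]_w f w) / c.
Proof.
move=> c0 f0 F; have mA := measurable_ge c (integ_meas F).
rewrite ler_pdivlMr// -mean_indic// mulrC -(meanZ c (integ_indic mA)).
apply: mean_le => //; first exact/integZ/integ_indic.
by move=> w; rewrite indicE; case: (boolP (w \in _)) => h; rewrite ?mulr1 ?mulr0 //;
  move: h; rewrite inE.
Qed.

End integ.

(** * Independence of functions of disjoint groups of variables *)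

Section independence.
Context d (T : measurableType d) (R : realType) (P : probability T R).

(** Independence of two real random variables. *)
Definition indep2 (f g : T -> R) := forall A B : set R,
  measurable A -> measurable B ->
  P (f @^-1` A `&` g @^-1` B) = (P (f @^-1` A) * P (g @^-1` B))%E.

(** The joint law of f and g is the product of their laws, and Fubini's theorem
    applies to the product of the coordinates. *)
Lemma indep2_mean f g : indep2 f g -> integ P f -> integ P g ->
  integ P (fun w => f w * g w) /\
  \int[P]_w (f w * g w) = (\int[P]_w f w) * (\int[P]_w g w).
Proof.
move=> fg If Ig.
have mf := integ_meas If; have mg := integ_meas Ig.
pose X : {RV P >-> R} :=
  MeasurableFun.Pack (MeasurableFun.Class (isMeasurableFun.Build _ _ _ _ _ mf)).
pose Y : {RV P >-> R} :=
  MeasurableFun.Pack (MeasurableFun.Class (isMeasurableFun.Build _ _ _ _ _ mg)).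
have mh : measurable_fun setT (fun w => (f w, g w)).
  exact: measurable_fun_pair.
pose Z : {RV P >-> (R * R)%type} :=
  MeasurableFun.Pack (MeasurableFun.Class (isMeasurableFun.Build _ _ _ _ _ mh)).
have ZE A : measurable A ->
    (distribution P X \x distribution P Y)%E A = distribution P Z A.
  apply: product_measure_unique => A' B' mA' mB'.
  exact: (fg A' B' mA' mB').
pose h (p : R * R) := (p.1 * p.2)%:E : \bar R.
have mhh : measurable_fun setT h.
  apply/measurable_EFinP; apply: measurable_funM;
    [exact: measurable_fst|exact: measurable_snd].
have iX : (distribution P X).-integrable setT EFin.
  by apply: integrable_pushforward.
have iY : (distribution P Y).-integrable setT EFin.
  by apply: integrable_pushforward.
have inner x : (\int[distribution P Y]_y h (x, y) = x%:E * (\int[P]_w g w)%:E)%E.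
  rewrite -(EFin_mean Ig) (_ : (\int[P]_w (g w)%:E)%E = \int[distribution P Y]_y y%:E)%E.
    by rewrite -integralZl.
  by rewrite integral_distribution.
have innerX : (\int[distribution P X]_x x%:E = (\int[P]_w f w)%:E)%E.
  by rewrite -(EFin_mean If) integral_distribution.
have inth : (distribution P X \x distribution P Y)%E.-integrable setT h.
  apply/(integrable12ltyP _ _ mhh).
  have iaY := integrable_norm iY; have iaX := integrable_norm iX.
  have fY : (\int[distribution P Y]_y `|y : R|%:E)%E \is a fin_num.
    exact: integrable_fin_num.
  rewrite (eq_integral (fun x : R => `|x|%:E *
      (fine (\int[distribution P Y]_y `|y : R|%:E)%E)%:E)%E); last first.
    move=> x _; rewrite fineK// -integralZl//.
    by apply: eq_integral => y _; rewrite /h/= normrM EFinM.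
  rewrite integralZr//; apply: lte_mul_pinfty.
  - by apply: integral_ge0 => x _; rewrite lee_fin.
  - exact: integrable_fin_num.
  - by rewrite ltry.
have eqI (u : R * R -> \bar R) : measurable_fun setT u ->
    (\int[(distribution P X \x distribution P Y)]_z u z
       = \int[distribution P Z]_z u z)%E.
  by move=> _; apply: eq_measure_integral => A mA _; exact: ZE.
have ifg : integ P (fun w => f w * g w).
  apply/integrableP; split.
    apply/measurable_EFinP; exact: measurable_funM.
  move/integrableP : inth => [_].
  rewrite eqI; last exact: measurableT_comp.
  by rewrite ge0_integral_distribution//; exact: measurableT_comp.
split => //.
have : (\int[distribution P Z]_z h z)%E = (\int[P]_w (f w * g w))%:E.
  by rewrite integral_distribution ?EFin_mean.
rewrite -eqI// -integral12_prod_meas1//.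
rewrite (eq_integral (fun x : R => x%:E * (\int[P]_w g w)%:E)%E); last first.
  by move=> x _; exact: inner.
by rewrite integralZr// innerX => -[].
Qed.

Context (I : finType) (X : I -> {RV P >-> R}).
Hypothesis indX : mutually_independent X.

(** The events that constrain each X i with i in U to a Borel set; they form a
    pi-system. *)
Definition cylinders (U : {set I}) : set (set T) :=
  [set B | exists2 A : I -> set R, forall i, measurable (A i) &
    B = \bigcap_(i in [set` U]) X i @^-1` A i].

Lemma mbigcap (U : {set I}) (A : I -> set R) : (forall i, measurable (A i)) ->
  measurable (\bigcap_(i in [set` U]) X i @^-1` A i).
Proof.
move=> mA; apply: fin_bigcap_measurable => // i _.
by rewrite -[X in measurable X]setTI; exact: measurable_funPT.
Qed.

Lemma measurable_cylinders U : cylinders U `<=` measurable.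
Proof. by move=> _ [A mA ->]; exact: mbigcap. Qed.

Lemma cylinders_setI U : setI_closed (cylinders U).
Proof.
move=> _ _ [A mA ->] [B mB ->]; exists (fun i => A i `&` B i).
  by move=> i; exact: measurableI.
by rewrite -bigcapI.
Qed.

Lemma cylindersT U : cylinders U setT.
Proof.
by exists (fun=> setT) => //; apply/esym/seteqP; split => // w _ i _.
Qed.

Lemma cylinders_indep (U V : {set I}) A B : {in U, forall i, i \notin V} ->
  cylinders U A -> cylinders V B -> P (A `&` B) = (P A * P B)%E.
Proof.
move=> dUV [A' mA ->] [B' mB ->].
pose C i := if i \in U then A' i else B' i.
have mC i : measurable (C i) by rewrite /C; case: ifP.
have CU i : i \in U -> C i = A' i by rewrite /C => ->.
have CV i : i \in V -> C i = B' i.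
  by move=> iV; rewrite /C; case: ifPn => // /dUV; rewrite iV.
have -> : \bigcap_(i in [set` U]) X i @^-1` A' i `&`
    \bigcap_(i in [set` V]) X i @^-1` B' i =
    \bigcap_(i in [set` U :|: V]) X i @^-1` C i.
  apply/seteqP; split => [w [h1 h2] i /=|w h].
    rewrite inE => /orP[iU|iV]; [rewrite CU//; exact: h1|rewrite CV//; exact: h2].
  split => i /= iU; [rewrite -CU//|rewrite -CV//]; apply: (h i);
    by rewrite /= inE iU ?orbT.
rewrite !indX// (eq_bigl [predU U & V]); last by move=> i; rewrite !inE.
rewrite bigU//=; last first.
  by apply/pred0P => i /=; apply/negP => /andP[/dUV/negP].
by congr (_ * _)%E; apply: eq_bigr => i iU; [rewrite CU|rewrite CV].
Qed.

(** The product rule extends from cylinders to generated sigma-algebras, one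
    factor at a time. *)
Lemma sigma_cylinders_indep (U V : {set I}) A B : {in U, forall i, i \notin V} ->
  <<s cylinders U >> A -> <<s cylinders V >> B ->
  P (A `&` B) = (P A * P B)%E.
Proof.
move=> dUV sA sB.
have mS W C : <<s cylinders W >> C -> measurable C.
  apply: smallest_sub; first exact: sigma_algebra_measurable.
  exact: measurable_cylinders.
have key (G : set (set T)) (C : set T) : measurable C -> setI_closed G ->
    G `<=` measurable -> G setT ->
    (forall D, G D -> P (D `&` C) = (P D * P C)%E) ->
    forall D, <<s G >> D -> P (D `&` C) = (P D * P C)%E.
  move=> mC GI Gm GT PG D sD.
  (* D |-> P (D & C) and D |-> P D * P C are finite measures *)
  have PC0 : 0 <= fine (P C) by rewrite fine_ge0.
  pose m2 := mscale (NngNum PC0) P.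
  have m2E E : m2 E = (P E * P C)%E.
    by rewrite /m2 /mscale/= fineK ?fin_num_measure// muleC.
  rewrite -m2E; pose m1 : {measure set T -> \bar R} := mrestr P mC.
  change (m1 D = m2 D).
  apply: (g_sigma_algebra_measure_unique G _ (fun=> setT)) sD => //.
  - by apply/seteqP; split => // w _; exists 0.
  - by move=> E GE; apply: (etrans _ (esym (m2E E))); exact: PG.
  - move=> _; rewrite /m1/= /mrestr setTI.
    by rewrite -ge0_fin_numE ?fin_num_measure.
apply: (key (cylinders U)) => //.
- exact: mS sB.
- exact: cylinders_setI.
- exact: measurable_cylinders.
- exact: cylindersT.
move=> D cD; rewrite setIC muleC; apply: (key (cylinders V)) => //.
- exact: measurable_cylinders cD.
- exact: cylinders_setI.
- exact: measurable_cylinders.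
- exact: cylindersT.
by move=> E cE; rewrite setIC muleC; exact: cylinders_indep dUV cD cE.
Qed.

(** The function f is measurable for the sigma-algebra generated by the X i, i in U. *)
Definition depends_on (U : {set I}) (f : T -> R) :=
  measurable_fun setT (f : g_sigma_algebraType (cylinders U) -> R).

Lemma depends_on_measurable U f : depends_on U f -> measurable_fun setT f.
Proof.
move=> Uf _ B mB; rewrite setTI.
have := Uf measurableT B mB; rewrite setTI.
apply: smallest_sub; first exact: sigma_algebra_measurable.
exact: measurable_cylinders.
Qed.

Lemma depends_on_indep (U V : {set I}) f g : {in U, forall i, i \notin V} -> depends_on U f ->
  depends_on V g -> indep2 f g.
Proof.
move=> dUV Uf Vg A B mA mB; apply: sigma_cylinders_indep dUV _ _.
  by have := Uf measurableT A mA; rewrite setTI.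
by have := Vg measurableT B mB; rewrite setTI.
Qed.

Lemma depends_on_var (U : {set I}) i : i \in U -> depends_on U (X i).
Proof.
move=> iU _ B mB; rewrite setTI; apply: sub_sigma_algebra.
exists (fun j => if j == i then B else setT).
  by move=> j; case: ifP.
apply/seteqP; split => [w /= wB j _|w /(_ i iU)].
  by case: eqP => // ->.
by rewrite /= eqxx.
Qed.

Lemma depends_on_subset (U V : {set I}) f : U \subset V -> depends_on U f ->
  depends_on V f.
Proof.
move=> /fintype.subsetP UV Uf _ B mB; rewrite setTI.
have := Uf measurableT B mB; rewrite setTI.
apply: sub_smallest2r => // _ [A mA ->].
exists (fun i => if i \in U then A i else setT).
  by move=> i; case: ifP.
apply/seteqP; split => w /= h i iV.
  by case: ifP => // iU; exact: h.
by have := h i (UV _ iV); rewrite iV.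
Qed.

Lemma depends_on_cst U c : depends_on U (fun=> c).
Proof. exact: measurable_cst. Qed.

Lemma depends_onD U f g : depends_on U f -> depends_on U g ->
  depends_on U (fun w => f w + g w).
Proof. exact: measurable_funD. Qed.

Lemma depends_onB U f g : depends_on U f -> depends_on U g ->
  depends_on U (fun w => f w - g w).
Proof. exact: measurable_funB. Qed.

Lemma depends_onM U f g : depends_on U f -> depends_on U g ->
  depends_on U (fun w => f w * g w).
Proof. exact: measurable_funM. Qed.

Lemma depends_on_comp U f (h : R -> R) : measurable_fun setT h ->
  depends_on U f -> depends_on U (fun w => h (f w)).
Proof. by move=> mh Uf; exact: (measurableT_comp mh Uf). Qed.

Lemma depends_on_sum U (J : Type) (s : seq J) (Q : pred J) (f : J -> T -> R) :
  (forall j, Q j -> depends_on U (f j)) ->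
  depends_on U (fun w => \sum_(j <- s | Q j) f j w).
Proof.
move=> F; elim: s => [|j s IH].
  by under eq_fun do rewrite big_nil; exact: depends_on_cst.
under eq_fun do rewrite big_cons; case: (boolP (Q j)) => // Qj.
by apply: depends_onD => //; exact: F.
Qed.

Lemma depends_on_mean (U V : {set I}) f g : {in U, forall i, i \notin V} -> depends_on U f ->
  depends_on V g -> integ P f -> integ P g ->
  integ P (fun w => f w * g w) /\
  \int[P]_w (f w * g w) = (\int[P]_w f w) * (\int[P]_w g w).
Proof. by move=> dUV Uf Vg; exact/indep2_mean/(depends_on_indep dUV). Qed.

End independence.

(** * Taylor bounds *)

Section calculus.
Context {R : realType}.
Implicit Types (f g df : R -> R) (a b C x y z h u v : R).

Lemma der_eq f x u u' : is_derive x 1 f u -> u = u' -> is_derive x 1 f u'.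
Proof. by move=> F <-. Qed.

Lemma der_cst x C : is_derive x 1 (fun=> C) 0.
Proof. exact: is_derive_cst. Qed.

Lemma der_id x : is_derive x 1 (fun z => z) 1.
Proof. exact: is_derive_id. Qed.

Lemma derD f g x u v : is_derive x 1 f u -> is_derive x 1 g v ->
  is_derive x 1 (fun z => f z + g z) (u + v).
Proof. by move=> F G; exact: is_deriveD. Qed.

Lemma derB f g x u v : is_derive x 1 f u -> is_derive x 1 g v ->
  is_derive x 1 (fun z => f z - g z) (u - v).
Proof. by move=> F G; exact: is_deriveB. Qed.

Lemma derN f x u : is_derive x 1 f u -> is_derive x 1 (fun z => - f z) (- u).
Proof. by move=> F; exact: is_deriveN. Qed.

Lemma derM f g x u v : is_derive x 1 f u -> is_derive x 1 g v ->
  is_derive x 1 (fun z => f z * g z) (f x * v + g x * u).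
Proof. by move=> F G; exact: is_deriveM. Qed.

Lemma derX2 f x u : is_derive x 1 f u ->
  is_derive x 1 (fun z => f z ^+ 2) (2 * f x * u).
Proof. by move=> F; apply: der_eq (derM F F) _; ring. Qed.

Lemma derV f x u : f x != 0 -> is_derive x 1 f u ->
  is_derive x 1 (fun z => (f z)^-1) (- (f x) ^- 2 * u).
Proof. by move=> f0 F; exact: is_deriveV. Qed.

Lemma der_comp f g x u v : is_derive (g x) 1 f u -> is_derive x 1 g v ->
  is_derive x 1 (fun z => f (g z)) (u * v).
Proof. by move=> F G; exact: is_derive1_comp. Qed.

Lemma le_mvt f df a b C : a <= b ->
  (forall x, a <= x <= b -> is_derive x 1 f (df x)) ->
  (forall x, a <= x <= b -> `|df x| <= C) ->
  `|f b - f a| <= C * (b - a).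
Proof.
move=> ab fdf dfC.
have [||c] := @MVT_segment R f df a b ab.
- by move=> x; rewrite in_itv/= => /andP[ax xb]; apply: fdf; rewrite !ltW.
- apply: derivable_within_continuous => x; rewrite in_itv/= => xab.
  exact: (@ex_derive _ _ _ _ _ _ _ (fdf x xab)).
rewrite in_itv/= => cab ->.
by rewrite normrM (ger0_norm (_ : 0 <= b - a)) ?subr_ge0// ler_wpM2r ?subr_ge0// dfC.
Qed.

Lemma le_mvt0 f df h C : (forall x, is_derive x 1 f (df x)) ->
  (forall x, `|x| <= `|h| -> `|df x| <= C) -> `|f h - f 0| <= C * `|h|.
Proof.
move=> fdf dfC; case: (lerP 0 h) => h0.
  rewrite (ger0_norm h0) -[X in _ <= _ * X]subr0.
  apply: (@le_mvt f df) => // x /andP[x0 xh].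
  by apply: dfC; rewrite !ger0_norm.
rewrite distrC (ltr0_norm h0) -[X in _ <= _ * X]sub0r; apply: (@le_mvt f df) => //.
  exact: ltW.
by move=> x /andP[x0 xh]; apply: dfC; rewrite (ltr0_norm h0) (ler0_norm xh) lerN2.
Qed.

(** A crude Taylor bound, obtained by applying the mean value inequality three
    times. *)
Lemma taylor3 f f1 f2 f3 C x h :
  (forall y, is_derive y 1 f (f1 y)) -> (forall y, is_derive y 1 f1 (f2 y)) ->
  (forall y, is_derive y 1 f2 (f3 y)) -> (forall y, `|f3 y| <= C) ->
  `|f (x + h) - (f x + f1 x * h + f2 x * h ^+ 2 / 2)| <= C * `|h| ^+ 3.
Proof.
move=> d1 d2 d3 f3C.
have shift (g g' : R -> R) (y : R) : (forall z, is_derive z 1 g (g' z)) ->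
    is_derive y 1 (fun z => g (x + z)) (g' (x + y)).
  move=> gg; have := der_comp (gg (x + y)) (derD (der_cst y x) (der_id y)).
  by rewrite add0r mulr1.
have C0 : 0 <= C by apply: le_trans (f3C 0).
have step2 y : `|f2 (x + y) - f2 x| <= C * `|y|.
  have := @le_mvt0 (fun z => f2 (x + z)) (fun z => f3 (x + z)) y C.
  by rewrite addr0; apply => // z; exact: shift.
have step1 y : `|f1 (x + y) - f1 x - f2 x * y| <= C * `|y| ^+ 2.
  have := @le_mvt0 (fun z => f1 (x + z) - f1 x - f2 x * z)
    (fun z => f2 (x + z) - f2 x) y (C * `|y|).
  rewrite addr0 subrr mulr0 subrr subr0 -mulrA; apply.
  - move=> z; apply: der_eq (derB (derB (shift f1 f2 z d2) (der_cst z _))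
      (derM (der_cst z _) (der_id z))) _; ring.
  - by move=> z zy; apply: le_trans (step2 z) _; exact: ler_wpM2l.
have -> : C * `|h| ^+ 3 = C * `|h| ^+ 2 * `|h| by rewrite -mulrA -exprSr.
have := @le_mvt0 (fun z => f (x + z) - (f x + f1 x * z + f2 x * z ^+ 2 / 2))
    (fun z => f1 (x + z) - f1 x - f2 x * z) h (C * `|h| ^+ 2).
rewrite addr0 expr0n/= !mulr0 mul0r !addr0 subrr subr0; apply.
- move=> z; apply: der_eq (derB (shift f f1 z d1)
    (derD (derD (der_cst z _) (derM (der_cst z _) (der_id z)))
      (derM (derM (der_cst z _) (derX2 (der_id z))) (der_cst z _)))) _.
  by field.
- move=> z zy; apply: le_trans (step1 z) _.
  by apply: ler_wpM2l => //; apply: lerXn2r; rewrite ?nnegrE.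
Qed.

End calculus.

(** * The standard normal distribution function and the heat flow *)

Section gauss.
Context {R : realType}.
Implicit Types (x y z t a : R).

Local Notation phi := (normal_pdf (0 : R) 1).

(** The distribution function of the standard normal law. *)
Definition Phi y : R := fine (normal_prob (0 : R) 1 `]-oo, y]).

Lemma PhiE y : (Phi y)%:E = normal_prob (0 : R) 1 `]-oo, y].
Proof. by rewrite /Phi fineK// fin_num_measure. Qed.

Lemma phiE y : phi y = normal_peak 1 * expR (- y ^+ 2 / 2).
Proof.
rewrite normal_pdfE ?oner_neq0// /normal_fun subr0 expr1n.
by [].
Qed.

Lemma phi_derive y : is_derive y 1 phi (- y * phi y).
Proof.
rewrite (_ : phi = fun z => normal_peak 1 * expR (- z ^+ 2 / 2)); last first.
  by apply/funext => z; exact: phiE.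
apply: der_eq (derM (der_cst y _) (der_comp (is_derive_expR _)
  (derM (derN (derX2 (der_id y))) (der_cst y _)))) _; by field.
Qed.

Lemma Phi_derive y : is_derive y 1 Phi (phi y).
Proof.
have [] := @continuous_FTC1 R phi -oo%O y (y + 1).
- by rewrite ltrDl.
- by apply: integrableS (integrable_normal_pdf 0 1).
- by rewrite ltNyr.
- exact: continuous_normal_pdf.
move=> dP; rewrite derive1E => eP.
apply: DeriveDef; [exact: dP|exact: eP].
Qed.

Lemma phi_ge0 y : 0 <= phi y.
Proof. exact: normal_pdf_ge0. Qed.

Lemma peak_le1 : normal_peak (1 : R) <= 1.
Proof.
rewrite /normal_peak invf_le1; last first.
  by rewrite sqrtr_gt0 expr1n mul1r pmulrn_lgt0// pi_gt0.
rewrite -[leLHS]sqrtr1 ler_wsqrtr// expr1n mul1r.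
by have := pi_ge2 R; lra.
Qed.

(** A polynomial substitute for the Gaussian decay, strong enough to absorb
    cubic factors. *)
Lemma phi_decay y : phi y * (1 + y ^+ 2 / 4) ^+ 2 <= 1.
Proof.
(* exp (- y ^ 2 / 2) = exp (y ^ 2 / 4) ^ - 2 and 1 + u <= exp u *)
rewrite phiE -mulrA mulr_ile1 ?normal_peak_ge0 ?peak_le1//.
  by rewrite mulr_ge0 ?expR_ge0 ?sqr_ge0.
have h : 1 + y ^+ 2 / 4 <= expR (y ^+ 2 / 4) by apply: expR_ge1Dx.
have -> : expR (- y ^+ 2 / 2) = (expR (y ^+ 2 / 4)) ^- 2.
  by rewrite -expRM_natl -expRN; congr expR; by field.
rewrite mulrC ler_pdivrMr ?exprn_gt0 ?expR_gt0// mul1r lerXn2r ?nnegrE ?expR_ge0//.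
by have := sqr_ge0 y; lra.
Qed.

Lemma phi_mul_le (q : R -> R) y :
  `|q y| <= 16 * (1 + y ^+ 2 / 4) ^+ 2 -> `|q y * phi y| <= 16.
Proof.
move=> hq; rewrite normrM (ger0_norm (phi_ge0 y)).
apply: (@le_trans _ _ (16 * (1 + y ^+ 2 / 4) ^+ 2 * phi y)).
  by rewrite ler_wpM2r ?phi_ge0.
by rewrite -mulrA mulrC -ler_pdivlMr// divff// mulrC phi_decay.
Qed.

Lemma Phi_ge0 y : 0 <= Phi y. Proof. exact: fine_ge0. Qed.

Lemma Phi_le1 y : Phi y <= 1.
Proof. by rewrite -lee_fin PhiE probability_le1. Qed.

Lemma Phi_nd x y : x <= y -> Phi x <= Phi y.
Proof.
move=> xy; rewrite -lee_fin !PhiE; apply: le_measure; rewrite ?inE//.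
by apply: subset_itvl; rewrite bnd_simp.
Qed.

Lemma continuous_Phi : continuous Phi.
Proof.
move=> y; apply: differentiable_continuous; apply/derivable1_diffP.
exact: (@ex_derive _ _ _ _ _ _ _ (Phi_derive y)).
Qed.

Lemma measurable_Phi : measurable_fun setT Phi.
Proof. exact: continuous_measurable_fun continuous_Phi. Qed.

Lemma measurable_phi : measurable_fun setT phi.
Proof. exact: measurable_normal_pdf. Qed.

Let mid : measurable_fun setT (fun x : measurableTypeR R => x : R).
Proof. exact: measurable_id. Qed.

Let gaussRV : {RV (normal_prob (0 : R) 1) >-> R} :=
  MeasurableFun.Pack (MeasurableFun.Class (isMeasurableFun.Build _ _ _ _ _ mid)).

Lemma Phi_y : Phi x @[x --> +oo] --> (1 : R).
Proof. by have /fine_cvg := @cvg_cdfy1 _ _ R _ gaussRV. Qed.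

Lemma Phi_Ny : Phi x @[x --> -oo] --> (0 : R).
Proof. by have /fine_cvg := @cvg_cdfNy0 _ _ R _ gaussRV. Qed.

(** [heat a t x] is the value at x0 of the distribution function of the normal
    law with mean x and variance a + t, for a + t > 0.  It solves the heat
    equation: its time derivative is half of [heat_xx].  The names of the derivatives list the
    differentiations; [isd] is the inverse standard deviation. *)
Variable x0 : R.

Definition isd a t : R := (Num.sqrt (a + t))^-1.
Definition heat a t x : R := Phi ((x0 - x) * isd a t).
Definition heat_x a t x : R := - isd a t * phi ((x0 - x) * isd a t).
Definition heat_xx a t x : R :=
  - isd a t ^+ 2 * (((x0 - x) * isd a t) * phi ((x0 - x) * isd a t)).
Definition heat_xxx a t x : R :=
  isd a t ^+ 3 * ((1 - ((x0 - x) * isd a t) ^+ 2) * phi ((x0 - x) * isd a t)).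
Definition heat_xxt a t x : R := isd a t ^+ 4 *
  ((3 * ((x0 - x) * isd a t) - ((x0 - x) * isd a t) ^+ 3) / 2 *
  phi ((x0 - x) * isd a t)).

Lemma isd_derive a t : 0 < a + t ->
  is_derive t 1 (isd a) (- isd a t ^+ 3 / 2).
Proof.
move=> at0; have s0 : Num.sqrt (a + t) != 0 by rewrite gt_eqF// sqrtr_gt0.
have -> : isd a = (fun z => (Num.sqrt (a + z))^-1) by [].
apply: der_eq (derV (f := fun z => Num.sqrt (a + z)) s0 (der_comp (is_derive1_sqrt at0)
  (derD (der_cst t a) (der_id t)))) _.
by rewrite /isd; field.
Qed.

Lemma isd_ge0 a t : 0 <= isd a t. Proof. by rewrite invr_ge0. Qed.

Lemma isd_le a t : 0 < a -> 0 <= t -> isd a t <= (Num.sqrt a)^-1.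
Proof.
move=> a0 t0; rewrite lef_pV2 ?posrE ?sqrtr_gt0//; last by rewrite ltr_wpDr.
by rewrite ler_wsqrtr// lerDl.
Qed.

Let arg_derive a t x : is_derive x 1 (fun z => (x0 - z) * isd a t) (- isd a t).
Proof.
apply: der_eq (derM (derB (der_cst x x0) (der_id x)) (der_cst x _)) _; ring.
Qed.

Lemma heat_derive a t x : is_derive x 1 (heat a t) (heat_x a t x).
Proof.
apply: der_eq (der_comp (Phi_derive _) (arg_derive a t x)) _.
by rewrite /heat_x; ring.
Qed.

Lemma heat_x_derive a t x : is_derive x 1 (heat_x a t) (heat_xx a t x).
Proof.
apply: der_eq (derM (der_cst x _) (der_comp (phi_derive _) (arg_derive a t x))) _.
by rewrite /heat_xx; ring.
Qed.

Lemma heat_xx_derive a t x : is_derive x 1 (heat_xx a t) (heat_xxx a t x).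
Proof.
apply: der_eq (derM (der_cst x _) (derM (arg_derive a t x)
  (der_comp (phi_derive _) (arg_derive a t x)))) _.
by rewrite /heat_xxx; ring.
Qed.

Let argt_derive a t x : 0 < a + t ->
  is_derive t 1 (fun z => (x0 - x) * isd a z) ((x0 - x) * (- isd a t ^+ 3 / 2)).
Proof.
move=> at0; apply: der_eq (derM (der_cst t _) (isd_derive at0)) _; ring.
Qed.

Lemma heat_derive_time a t x : 0 < a + t ->
  is_derive t 1 (fun z => heat a z x) (heat_xx a t x / 2).
Proof.
move=> at0; apply: der_eq (der_comp (Phi_derive _) (argt_derive x at0)) _.
by rewrite /heat_xx; field.
Qed.

Lemma heat_xx_derive_time a t x : 0 < a + t ->
  is_derive t 1 (fun z => heat_xx a z x) (heat_xxt a t x).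
Proof.
move=> at0; apply: der_eq (derM (derN (derX2 (isd_derive at0)))
  (derM (argt_derive x at0) (der_comp (phi_derive _) (argt_derive x at0)))) _.
by rewrite /heat_xxt; field.
Qed.

(** A common bound for these derivatives at nonnegative times. *)
Definition heat_bound a : R :=
  16 * (1 + (Num.sqrt a)^-1 + (Num.sqrt a)^-1 ^+ 2 + (Num.sqrt a)^-1 ^+ 3 +
        (Num.sqrt a)^-1 ^+ 4).

Lemma heat_bound_ge0 a : 0 <= heat_bound a.
Proof.
have r0 : 0 <= (Num.sqrt a)^-1 by rewrite invr_ge0.
rewrite /heat_bound; have := exprn_ge0 2 r0; have := exprn_ge0 3 r0.
by have := exprn_ge0 4 r0; lra.
Qed.

Lemma heat_bound_ge m a t q : 0 < a -> 0 <= t -> (m <= 4)%N -> `|q| <= 16 ->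
  `|isd a t ^+ m * q| <= heat_bound a.
Proof.
move=> a0 t0 m4 q16; rewrite normrM normrX (ger0_norm (isd_ge0 a t)).
apply: (@le_trans _ _ ((Num.sqrt a)^-1 ^+ m * 16)).
  apply: ler_pM => //; first by rewrite exprn_ge0 ?isd_ge0.
  by apply: lerXn2r; rewrite ?nnegrE ?isd_ge0 ?invr_ge0 ?sqrtr_ge0 ?isd_le.
rewrite mulrC ler_wpM2l//.
have s0 : 0 <= (Num.sqrt a)^-1 by rewrite invr_ge0.
have p2 := exprn_ge0 2 s0; have p3 := exprn_ge0 3 s0.
have p4 := exprn_ge0 4 s0.
case: m m4 => [|[|[|[|[|//]]]]] _; rewrite ?expr0 ?expr1; lra.
Qed.

Lemma heat_x_le a t x : 0 < a -> 0 <= t -> `|heat_x a t x| <= heat_bound a.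
Proof.
move=> a0 t0; rewrite /heat_x mulNr -mulrN -[isd a t]expr1; apply: heat_bound_ge => //.
rewrite normrN -[X in `|X|]mul1r; apply: (@phi_mul_le (fun=> 1)).
by rewrite normr1; have := sqr_ge0 ((x0 - x) * isd a t ^+ 1); nra.
Qed.

Lemma heat_xx_le a t x : 0 < a -> 0 <= t -> `|heat_xx a t x| <= heat_bound a.
Proof.
move=> a0 t0; rewrite /heat_xx mulNr normrN; apply: heat_bound_ge => //.
set y := _ * isd a t; apply: (@phi_mul_le id) => /=.
rewrite ler_norml; apply/andP; split; nra.
Qed.

Lemma heat_xxx_le a t x : 0 < a -> 0 <= t -> `|heat_xxx a t x| <= heat_bound a.
Proof.
move=> a0 t0; apply: heat_bound_ge => //.
set y := _ * isd a t; apply: (@phi_mul_le (fun y => 1 - y ^+ 2)) => /=.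
by rewrite ler_norml; apply/andP; split; nra.
Qed.

Lemma heat_xxt_le a t x : 0 < a -> 0 <= t -> `|heat_xxt a t x| <= heat_bound a.
Proof.
move=> a0 t0; apply: heat_bound_ge => //.
set y := _ * isd a t; apply: (@phi_mul_le (fun y => (3 * y - y ^+ 3) / 2)) => /=.
have y2 : `|y| <= (1 + y ^+ 2) / 2.
  by rewrite ler_norml; apply/andP; split; have := sqr_ge0 (1 - y);
    have := sqr_ge0 (1 + y); nra.
apply: (@le_trans _ _ (`|y| * ((3 + y ^+ 2) / 2))).
  rewrite (_ : _ / 2 = y * ((3 - y ^+ 2) / 2)); last by field.
  rewrite normrM ler_wpM2l// ler_norml; apply/andP.
  by have := sqr_ge0 y; split; lra.
have h : 0 <= (3 + y ^+ 2) / 2 by have := sqr_ge0 y; lra.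
apply: le_trans (ler_wpM2r h y2) _.
by have := sqr_ge0 y; have := sqr_ge0 (y ^+ 2); nra.
Qed.

(** Expansion in time to the first order, written with the second space
    derivative. *)
Lemma heat_time_step a t v x : 0 < a -> 0 <= t -> 0 <= v ->
  `|heat a (t + v) x - (heat a t x + v * heat_xx a t x / 2)| <= heat_bound a * v ^+ 2.
Proof.
move=> a0 t0 v0.
have pos z : t <= z -> 0 < a + z by move=> tz; lra.
have B0 := heat_bound_ge0 a.
have s1 z : t <= z -> `|heat_xx a z x - heat_xx a t x| <= heat_bound a * (z - t).
  move=> tz; apply: (@le_mvt _ (fun z => heat_xx a z x) (fun z => heat_xxt a z x)) => //.
    by move=> y /andP[ty _]; apply: heat_xx_derive_time; exact: pos.
  by move=> y /andP[ty _]; apply: heat_xxt_le => //; exact: le_trans ty.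
pose f z := heat a z x - z * heat_xx a t x / 2.
have := @le_mvt _ f (fun z => heat_xx a z x / 2 - heat_xx a t x / 2) t (t + v) (heat_bound a * v).
have -> : f (t + v) - f t = heat a (t + v) x - (heat a t x + v * heat_xx a t x / 2).
  by rewrite /f; field.
rewrite (_ : t + v - t = v); last by ring.
rewrite (_ : heat_bound a * v ^+ 2 = heat_bound a * v * v); last by ring.
apply.
- by rewrite lerDl.
- move=> z /andP[tz _]; apply: der_eq (derB (heat_derive_time x (pos z tz))
    (derM (derM (der_id z) (der_cst z _)) (der_cst z _))) _; ring.
- move=> z /andP[tz zv]; rewrite -mulrBl normrM (ger0_norm (_ : 0 <= 2^-1)) ?invr_ge0//.
  have := s1 z tz; have : heat_bound a * (z - t) <= heat_bound a * v.
    by rewrite ler_wpM2l//; lra.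
  have := normr_ge0 (heat_xx a z x - heat_xx a t x); lra.
Qed.

Lemma heat_space_step a t x h : 0 < a -> 0 <= t ->
  `|heat a t (x + h) - (heat a t x + heat_x a t x * h + heat_xx a t x * h ^+ 2 / 2)|
     <= heat_bound a * `|h| ^+ 3.
Proof.
move=> a0 t0; apply: (@taylor3 _ (heat a t) (heat_x a t) (heat_xx a t) (heat_xxx a t)).
- by move=> y; exact: heat_derive.
- by move=> y; exact: heat_x_derive.
- by move=> y; exact: heat_xx_derive.
- by move=> y; exact: heat_xxx_le.
Qed.

Let measurable_arg a t : measurable_fun setT (fun x => (x0 - x) * isd a t).
Proof. by apply: measurable_funM => //; exact: measurable_funB. Qed.

Lemma measurable_heat a t : measurable_fun setT (heat a t).
Proof. exact: measurableT_comp measurable_Phi (measurable_arg a t). Qed.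

Let measurable_phiarg a t :
  measurable_fun setT (fun x => phi ((x0 - x) * isd a t)).
Proof. exact: measurableT_comp measurable_phi (measurable_arg a t). Qed.

Lemma measurable_heat_x a t : measurable_fun setT (heat_x a t).
Proof. by apply: measurable_funM. Qed.

Lemma measurable_heat_xx a t : measurable_fun setT (heat_xx a t).
Proof. by do 2 (apply: measurable_funM => //). Qed.

Lemma heat_ge0 a t x : 0 <= heat a t x. Proof. exact: Phi_ge0. Qed.
Lemma heat_le1 a t x : heat a t x <= 1. Proof. exact: Phi_le1. Qed.

End gauss.

(** * Lindeberg's replacement method *)

Section powers.
Context d (T : measurableType d) (R : realType) (P : probability T R).
Implicit Types f g : T -> R.

Lemma ler_normX (x : R) m p : (m <= p)%N -> `|x| ^+ m <= 1 + `|x| ^+ p.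
Proof.
move=> mp; have [x1|x1] := lerP `|x| 1.
  by apply: le_trans (exprn_ile1 m (normr_ge0 x) x1) _; rewrite lerDl exprn_ge0.
by apply: le_trans (ler_weXn2l (ltW x1) mp) _; rewrite lerDr.
Qed.

Lemma integ_powS f m p : (m <= p)%N -> measurable_fun setT f ->
  integ P (fun w => `|f w| ^+ p) -> integ P (fun w => `|f w| ^+ m).
Proof.
move=> mp mf F; apply: (@integ_le _ _ _ _ _ (fun w => 1 + `|f w| ^+ p)).
- by apply: measurable_funX; exact: measurableT_comp.
- by apply: integD => //; exact: integ_cst.
- by move=> w; rewrite ger0_norm ?exprn_ge0// ler_normX.
Qed.

Lemma integ_of_norm f : measurable_fun setT f -> integ P (fun w => `|f w|) ->
  integ P f.
Proof. by move=> mf F; exact: integ_le F _. Qed.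

Lemma integ_pow1 f p : (0 < p)%N -> measurable_fun setT f ->
  integ P (fun w => `|f w| ^+ p) -> integ P f.
Proof. by move=> p0 mf F; apply: integ_of_norm => //; exact: (integ_powS p0 mf F). Qed.

Lemma integ_pow f m p : (m <= p)%N -> measurable_fun setT f ->
  integ P (fun w => `|f w| ^+ p) -> integ P (fun w => f w ^+ m).
Proof.
move=> mp mf F; apply: integ_le (integ_powS mp mf F) _.
  exact: measurable_funX.
by move=> w; rewrite normrX.
Qed.

End powers.

Lemma telescope_le (R : realType) (g u : nat -> R) k :
  (forall m, (m < k)%N -> `|g m.+1 - g m| <= u m) ->
  `|g k - g 0%N| <= \sum_(l < k) u l.
Proof.
elim: k => [|k IH] gu; first by rewrite subrr normr0 big_ord0.
rewrite big_ord_recr/= (_ : g k.+1 - g 0%N = (g k - g 0%N) + (g k.+1 - g k)).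
  by apply: le_trans (ler_normD _ _) _; apply: lerD; [apply: IH => m mk; apply/gu/ltnW|exact: gu].
by ring.
Qed.

Section independent_sequence.
Context d (T : measurableType d) (R : realType) (P : probability T R).
Context (I : finType) (X : I -> {RV P >-> R}).
Hypothesis indX : mutually_independent X.
Variable V : nat -> {set I}.
Hypothesis dV : forall l m, (l < m)%N -> {in V l, forall i, i \notin V m}.

(** The indices used before step m. *)
Definition past m : {set I} := [set i | [exists l : 'I_m, i \in V l]]%SET.

Lemma past_disjoint m : {in past m, forall i, i \notin V m}.
Proof. by move=> i; rewrite inE => /existsP[l il]; exact: dV il. Qed.

Lemma sub_past l m : (l < m)%N -> V l \subset past m.
Proof.
move=> lm; apply/fintype.subsetP => i il; rewrite inE; apply/existsP.
by exists (Ordinal lm).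
Qed.

Variable xi : nat -> T -> R.
Hypothesis xiV : forall m, depends_on X (V m) (xi m).

(** The partial sums of the sequence. *)
Definition psum m w := \sum_(l < m) xi l w.

Lemma depends_on_psum m : depends_on X (past m) (psum m).
Proof.
apply: depends_on_sum => l _.
exact: depends_on_subset (sub_past (ltn_ord l)) (@xiV l).
Qed.

Lemma measurable_psum m : measurable_fun setT (psum m).
Proof. exact: depends_on_measurable (@depends_on_psum m). Qed.

Lemma measurable_xi m : measurable_fun setT (xi m).
Proof. exact: depends_on_measurable (@xiV m). Qed.

(** Functions of the past are independent of functions of step m. *)
Lemma past_mean m f g : depends_on X (past m) f -> depends_on X (V m) g ->
  integ P f -> integ P g ->
  integ P (fun w => f w * g w) /\
  \int[P]_w (f w * g w) = (\int[P]_w f w) * (\int[P]_w g w).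
Proof. exact: (depends_on_mean indX (@past_disjoint m)). Qed.

Hypothesis xi0 : forall m, \int[P]_w xi m w = 0.

Section variance.
Hypothesis ixi2 : forall m, integ P (fun w => xi m w ^+ 2).

Lemma integ_xi m : integ P (xi m).
Proof.
apply: (@integ_pow1 _ _ _ _ _ 2) => //; first exact: measurable_xi.
by under eq_fun do rewrite real_normK ?num_real//.
Qed.

(** Mean squares of centred independent variables add up. *)
Lemma psum2 m : integ P (psum m) /\ integ P (fun w => psum m w ^+ 2) /\
  \int[P]_w (psum m w ^+ 2) = \sum_(l < m) \int[P]_w (xi l w ^+ 2).
Proof.
elim: m => [|m [IH1 [IH2 IH3]]].
  have -> : psum 0 = fun=> 0 by apply/funext => w; rewrite /psum big_ord0.
  split; first exact: integ_cst.
  by rewrite expr0n; split; [exact: integ_cst|rewrite big_ord0 mean_cst].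
have E w : psum m.+1 w = psum m w + xi m w by rewrite /psum big_ord_recr.
have [i1 m1] := past_mean (@depends_on_psum m) (@xiV m) IH1 (integ_xi m).
have E2 w : psum m.+1 w ^+ 2 =
    psum m w ^+ 2 + 2 * (psum m w * xi m w) + xi m w ^+ 2.
  by rewrite E; ring.
have -> : psum m.+1 = fun w => psum m w + xi m w by apply/funext.
split; first by apply: integD => //; exact: integ_xi.
rewrite [X in integ P X](_ : _ = fun w =>
    psum m w ^+ 2 + 2 * (psum m w * xi m w) + xi m w ^+ 2); last first.
  by apply/funext => w; rewrite -E E2.
have i2 := integZ 2 i1; have i3 := integD IH2 i2.
split; first exact: integD.
rewrite (eq_Rintegral _ (g := fun w =>
    psum m w ^+ 2 + 2 * (psum m w * xi m w) + xi m w ^+ 2)); last first.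
  by move=> w _; rewrite -E E2.
by rewrite meanD// meanD// meanZ// m1 xi0 !mulr0 addr0 IH3 big_ord_recr.
Qed.

End variance.

Section lindeberg.
Hypothesis ixi3 : forall m, integ P (fun w => `|xi m w| ^+ 3).
Variables (k : nat) (x0 a : R).
Hypothesis a0 : 0 < a.

Let v m := \int[P]_w (xi m w ^+ 2).

Let v_ge0 m : 0 <= v m.
Proof. by apply: Rintegral_ge0 => w _; rewrite sqr_ge0. Qed.

(** The total variance of the variables from the m-th to the last. *)
Let t m := \sum_(m <= l < k) v l.

Let t_ge0 m : 0 <= t m.
Proof. by apply: sumr_ge0. Qed.

Local Notation G := (heat x0 a).
Local Notation G1 := (heat_x x0 a).
Local Notation G2 := (heat_xx x0 a).

(** Adding the m-th variable, or its variance to the time, has the same effect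
    on the mean of the heat flow up to third order terms. *)
Lemma lindeberg_step m : (m < k)%N ->
  `|\int[P]_w G (t m.+1) (psum m.+1 w) - \int[P]_w G (t m) (psum m w)|
    <= heat_bound a * (\int[P]_w (`|xi m w| ^+ 3) + v m ^+ 2).
Proof.
move=> mk; have tE : t m = t m.+1 + v m by rewrite /t big_ltn// addrC.
set s := t m.+1; have s0 : 0 <= s by exact: t_ge0.
have ix1 : integ P (xi m).
  by apply: (@integ_pow1 _ _ _ _ _ 3) => //; exact: measurable_xi.
have ix2 : integ P (fun w => xi m w ^+ 2).
  by apply: (@integ_pow _ _ _ P _ 2 3 isT (measurable_xi m)); exact: ixi3.
have bnd (h : R -> R) u C : measurable_fun setT h -> (forall x, `|h x| <= C) ->
    integ P (fun w => h (psum u w)).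
  move=> mh hC; apply: (@integ_bounded _ _ _ _ _ C) => //.
  by apply: measurableT_comp => //; exact: measurable_psum.
have Gn r x : `|G r x| <= 1 by rewrite ger0_norm ?heat_le1 ?heat_ge0.
have iG r u : integ P (fun w => G r (psum u w)).
  by apply: (bnd (G r) u 1) => //; exact: measurable_heat.
have iG1 : integ P (fun w => G1 s (psum m w)).
  by apply: (bnd _ m (heat_bound a)); [exact: measurable_heat_x|move=> x; exact: heat_x_le].
have iG2 : integ P (fun w => G2 s (psum m w)).
  by apply: (bnd _ m (heat_bound a)); [exact: measurable_heat_xx|move=> x; exact: heat_xx_le].
have dep h : measurable_fun setT h -> depends_on X (past m) (fun w => h (psum m w)).
  by move=> mh; apply: depends_on_comp => //; exact: depends_on_psum.
have [j1 e1] := past_mean (dep _ (measurable_heat_x x0 a s)) (@xiV m) iG1 ix1.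
have sqV : depends_on X (V m) (fun w => xi m w ^+ 2).
  apply: (@depends_on_comp _ _ _ _ _ X (V m) (xi m) (fun x => x ^+ 2)) => //.
have [j2 e2] := past_mean (dep _ (measurable_heat_xx x0 a s)) sqV iG2 ix2.
(* the Taylor polynomials in space, A, and in time, B, have the same mean *)
pose A w := G s (psum m w) + (G1 s (psum m w) * xi m w
  + 2^-1 * (G2 s (psum m w) * xi m w ^+ 2)).
pose B w := G s (psum m w) + (v m / 2) * G2 s (psum m w).
have iA : integ P A.
  by apply: integD => //; apply: integD => //; exact: integZ.
have iB : integ P B by apply: integD => //; exact: integZ.
have AB : \int[P]_w A w = \int[P]_w B w.
  rewrite meanD//; last by apply: integD => //; exact: integZ.
  rewrite meanD//; last exact: integZ.
  rewrite (meanZ _ j2) e1 e2 xi0 mulr0 add0r meanD//; last exact: integZ.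
  by rewrite (meanZ _ iG2) /v; ring.
have -> : \int[P]_w G s (psum m.+1 w) - \int[P]_w G (t m) (psum m w) =
    \int[P]_w (G s (psum m.+1 w) - A w) - \int[P]_w (G (t m) (psum m w) - B w).
  have eq_sub (p q p' q' p'' q'' : R) : p'' = p - p' -> q'' = q - q' -> p' = q' ->
    p - q = p'' - q'' by move=> -> -> ->; ring.
  exact: eq_sub (meanB (iG s m.+1) iA) (meanB (iG (t m) m) iB) AB.
have iDA := integB (iG s m.+1) iA; have iDB := integB (iG (t m) m) iB.
rewrite mulrDr; apply: le_trans (ler_normB _ _) _; apply: lerD.
  apply: le_trans (mean_abs iDA) _; rewrite -meanZ; last exact: ixi3.
  apply: mean_le; [exact: integ_abs|exact: integZ|move=> w].
  have := heat_space_step x0 (psum m w) (xi m w) a0 s0.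
  rewrite /psum big_ord_recr/= -/(psum m w); apply: le_trans.
  by rewrite le_eqVlt; apply/orP; left; apply/eqP; congr `|_ - _|; rewrite /A; field.
apply: le_trans (mean_abs iDB) _; rewrite -[leRHS](mean_cst P).
apply: mean_le; [exact: integ_abs|exact: integ_cst|move=> w].
have := heat_time_step x0 (psum m w) a0 s0 (v_ge0 m); rewrite -tE; apply: le_trans.
by rewrite le_eqVlt; apply/orP; left; apply/eqP; congr `|_ - _|; rewrite /B; field.
Qed.

(** Lindeberg's replacement argument, the Gaussian increments being encoded in
    the heat flow. *)
Theorem lindeberg :
  `|\int[P]_w G 0 (psum k w) - Phi (x0 / Num.sqrt (a + \sum_(l < k) v l))|
    <= heat_bound a * \sum_(l < k) (\int[P]_w (`|xi l w| ^+ 3) + v l ^+ 2).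
Proof.
have := @telescope_le _ (fun m => \int[P]_w G (t m) (psum m w)) _ k lindeberg_step.
rewrite -mulr_sumr.
have -> : \int[P]_w G (t 0) (psum 0 w) = Phi (x0 / Num.sqrt (a + \sum_(l < k) v l)).
  rewrite (eq_Rintegral _ (g := fun=> G (t 0) 0)); last first.
    by move=> w _; rewrite /psum big_ord0.
  by rewrite mean_cst /heat /isd subr0 /t big_mkord.
by have -> : t k = 0 by rewrite /t big_geq.
Qed.

End lindeberg.
End independent_sequence.

(** * From smoothed indicators to distribution functions *)

Section sandwich.
Context d (T : measurableType d) (R : realType) (P : probability T R).
Implicit Types (f : T -> R) (A : set T).

Lemma integ_heat f x a t : measurable_fun setT f ->
  integ P (fun w => heat x a t (f w)).
Proof.
move=> mf; apply: (@integ_bounded _ _ _ _ _ 1).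
  by apply: (measurableT_comp _ mf); exact: measurable_heat.
by move=> w; rewrite ger0_norm ?heat_ge0 ?heat_le1.
Qed.

Variables (S J : T -> R) (bad : set T) (x e a : R).
Hypotheses (mS : measurable_fun setT S) (mJ : measurable_fun setT J).
Hypothesis mbad : measurable bad.
Hypothesis upp : forall w, ~ bad w -> J w <= x -> S w <= x + e.
Hypothesis low : forall w, ~ bad w -> S w <= x - e -> J w <= x.

Let indicT A w : A w -> \1_A w = 1 :> R.
Proof. by move=> Aw; rewrite indicE mem_set. Qed.

Let indicF A w : ~ A w -> \1_A w = 0 :> R.
Proof. by move=> Aw; rewrite indicE memNset. Qed.

Let indic_ge0 A w : 0 <= \1_A w :> R.
Proof. by rewrite indicE. Qed.

(** Pointwise, the indicator of J <= x is at most the smoothed indicator of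
    S <= x + 2 * e, plus the defect of the latter on S <= x + e, plus the
    indicator of the bad event. *)
Lemma sandwich_le : fine (P [set w | J w <= x]) <=
  \int[P]_w heat (x + 2 * e) a 0 (S w) + (1 - Phi (e * isd a 0)) + fine (P bad).
Proof.
have mA := measurable_le x mJ.
have ih := integ_heat (x + 2 * e) a 0 mS.
have ihc := integD ih (integ_cst P (1 - Phi (e * isd a 0))).
rewrite -mean_indic// -(mean_indic P mbad) -[X in _ + X + _](mean_cst P).
rewrite -(meanD ih (integ_cst P _)) -(meanD ihc (integ_indic P mbad)).
apply: mean_le; [exact: integ_indic|exact: integD ihc (integ_indic P mbad)|move=> w].
have hp := heat_ge0 (x + 2 * e) a 0 (S w).
have cp := Phi_le1 (e * isd a 0).
have [Jw|Jw] := pselect (J w <= x); last first.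
  by rewrite indicF//; have := indic_ge0 bad w; lra.
rewrite indicT//; have [bw|bw] := pselect (bad w).
  by rewrite (indicT bw); lra.
rewrite (indicF bw); have Sw := upp bw Jw.
suff : Phi (e * isd a 0) <= heat (x + 2 * e) a 0 (S w) by lra.
by apply: Phi_nd; rewrite ler_wpM2r ?isd_ge0//; lra.
Qed.

Lemma sandwich_ge :
  \int[P]_w heat (x - 2 * e) a 0 (S w) - Phi (- e * isd a 0) - fine (P bad) <=
  fine (P [set w | J w <= x]).
Proof.
have mA := measurable_le x mJ.
have ih := integ_heat (x - 2 * e) a 0 mS.
have ihc := integB ih (integ_cst P (Phi (- e * isd a 0))).
rewrite -(mean_indic P mA) -(mean_indic P mbad) -[X in _ - X - _](mean_cst P).
rewrite -(meanB ih (integ_cst P _)) -(meanB ihc (integ_indic P mbad)).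
apply: mean_le; [exact: integB ihc (integ_indic P mbad)|exact: integ_indic|move=> w].
have hp := heat_le1 (x - 2 * e) a 0 (S w).
have cp := Phi_ge0 (- e * isd a 0).
have [Jw|Jw] := pselect (J w <= x).
  by rewrite (indicT Jw); have := indic_ge0 bad w; lra.
rewrite (indicF Jw); have [bw|bw] := pselect (bad w).
  by rewrite (indicT bw); lra.
rewrite (indicF bw).
have Sw : x - e < S w by rewrite ltNge; apply/negP => /(low bw).
suff : heat (x - 2 * e) a 0 (S w) <= Phi (- e * isd a 0) by lra.
by apply: Phi_nd; rewrite ler_wpM2r ?isd_ge0//; lra.
Qed.

End sandwich.

Section convergence.
Context {R : realType} (d : nat -> measure_display)
  (T : forall k, measurableType (d k)) (P : forall k, probability (T k) R).

Lemma Phi_tails (r : R) : 0 < r ->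
  exists2 M, 0 < M & forall y, M <= y -> 1 - r < Phi y /\ Phi (- y) < r.
Proof.
move=> r0.
have /cvgrPdist_lt /(_ _ r0) [M1 [_ h1]] := @Phi_y R.
have /cvgrPdist_lt /(_ _ r0) [M2 [_ h2]] := @Phi_Ny R.
exists (1 + `|M1| + `|M2|); first by rewrite -addrA ltr_pwDl// addr_ge0.
move=> y My; have n1 := ler_norm M1; have n2 := ler_norm (- M2).
have p1 := normr_ge0 M1; have p2 := normr_ge0 M2; rewrite normrN in n2.
have /h1 : M1 < y by lra.
have /h2 : - y < M2 by lra.
have := Phi_le1 y; have := Phi_ge0 (- y).
by rewrite /= sub0r normrN !ltr_norml; lra.
Qed.

(** First e is chosen by the continuity of Phi, then a so small that
    e / sqrt a reaches far into the tails. *)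
Lemma Phi_scaled_near (x r : R) : 0 < r -> exists e a : R, 0 < e /\ [/\ 0 < a,
  Phi ((x + 2 * e) / Num.sqrt (a + 1)) < Phi x + r,
  Phi x - r < Phi ((x - 2 * e) / Num.sqrt (a + 1)),
  1 - r < Phi (e * isd a 0) & Phi (- e * isd a 0) < r].
Proof.
move=> r0; have [M M0 hM] := Phi_tails r0.
have /cvgrPdist_lt /(_ _ r0) [dl /= dl0 hdl] := @continuous_Phi R x.
pose e := dl / 8; have e0 : 0 < e by rewrite /e; lra.
pose a := Num.min (dl / (4 * (`|x| + 1))) ((e / M) ^+ 2).
have x1 : 0 < `|x| + 1 by rewrite ltr_wpDl.
have a0 : 0 < a.
  by rewrite /a lt_min; apply/andP; split; [rewrite divr_gt0// mulr_gt0|rewrite exprn_gt0// divr_gt0].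
have a1 : a * (`|x| + 1) <= dl / 4.
  rewrite -ler_pdivlMr// (le_trans (_ : a <= dl / (4 * (`|x| + 1))))//.
    by rewrite /a ge_min lexx.
  by rewrite invfM mulrA.
have a2 : a <= (e / M) ^+ 2 by rewrite /a ge_min lexx orbT.
pose q := (Num.sqrt (a + 1))^-1.
have s1 : 0 < Num.sqrt (a + 1) by rewrite sqrtr_gt0; lra.
have s2 : Num.sqrt (a + 1) ^+ 2 = a + 1 by rewrite sqr_sqrtr//; lra.
have q0 : 0 < q by rewrite invr_gt0.
have qs : q * Num.sqrt (a + 1) = 1 by rewrite mulVf// gt_eqF.
have q1 : q <= 1.
  have : 1 <= Num.sqrt (a + 1) by rewrite -[leLHS]sqrtr1 ler_wsqrtr//; lra.
  nra.
have q2 : 1 - a <= q.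
  have : Num.sqrt (a + 1) <= 1 + a by nra.
  nra.
have close y : `|y - x| <= 2 * e -> `|Phi x - Phi (y * q)| < r.
  move=> yx; apply: hdl; rewrite /ball/=.
  have -> : x - y * q = x * (1 - q) - (y - x) * q by ring.
  apply: le_lt_trans (ler_normB _ _) _.
  rewrite !normrM (gtr0_norm q0) (ger0_norm (_ : 0 <= 1 - q)) ?subr_ge0//.
  have h1 : `|x| * (1 - q) <= dl / 4.
    apply: le_trans a1; have := normr_ge0 x; nra.
  have h2 : `|y - x| * q <= dl / 4.
    have := normr_ge0 (y - x); rewrite /e in yx; nra.
  lra.
have eM : M <= e * isd a 0.
  rewrite /isd addr0 ler_pdivlMr ?sqrtr_gt0// mulrC -ler_pdivlMr//.
  have eM0 : 0 <= e / M by rewrite divr_ge0// ltW.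
  by rewrite -(ger0_norm eM0) -sqrtr_sqr; exact: ler_wsqrtr.
exists e, a; split => //; split => //.
- have /close : `|x + 2 * e - x| <= 2 * e by rewrite addrC addKr ger0_norm//; lra.
  by rewrite ltr_norml -/q; lra.
- have /close : `|x - 2 * e - x| <= 2 * e.
    by rewrite addrC addKr normrN ger0_norm//; lra.
  by rewrite ltr_norml -/q; lra.
- by case: (hM _ eM).
- by rewrite mulNr; case: (hM _ eM).
Qed.

Let eps_sandwich (r F p F1 I1 F2 I2 t1 t2 b : R) :
  `|F1 - I1| < r / 4 -> `|F2 - I2| < r / 4 -> `|0 - b| < r / 4 ->
  F1 < F + r / 4 -> F - r / 4 < F2 -> 1 - r / 4 < t1 -> t2 < r / 4 ->
  p <= I1 + (1 - t1) + b -> I2 - t2 - b <= p -> `|F - p| < r.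
Proof. by rewrite !ltr_norml; lra. Qed.

(** Convergence of the means of the smoothed indicators of S, together with
    J being close to S outside an event of vanishing probability, gives the
    convergence of the distribution functions of J. *)
Theorem cvg_cdf_of_heat (S J : forall k, T k -> R) (x : R) :
  (forall k, measurable_fun setT (S k)) ->
  (forall k, measurable_fun setT (J k)) ->
  (forall y a, 0 < a -> \int[P k]_w heat y a 0 (S k w) @[k --> \oo] -->
     Phi (y / Num.sqrt (a + 1))) ->
  (forall e, 0 < e -> exists bad : forall k, set (T k),
    fine (P k (bad k)) @[k --> \oo] --> (0 : R) /\
    \forall k \near \oo, measurable (bad k) /\ forall w, ~ bad k w ->
      (J k w <= x -> S k w <= x + e) /\ (S k w <= x - e -> J k w <= x)) ->
  fine (P k [set w | J k w <= x]) @[k --> \oo] --> Phi x.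
Proof.
move=> mS mJ hS hJ; apply/cvgrPdist_lt => r r0.
have r4 : 0 < r / 4 by lra.
have [e [a [e0 [a0 h1 h2 h3 h4]]]] := Phi_scaled_near x r4.
have [bad [bad0 hbad]] := hJ e e0.
have /cvgrPdist_lt /(_ _ r4) c1 := hS (x + 2 * e) a a0.
have /cvgrPdist_lt /(_ _ r4) c2 := hS (x - 2 * e) a a0.
move/cvgrPdist_lt : bad0 => /(_ _ r4) c3.
apply: filterS (filterI (filterI c1 c2) (filterI c3 hbad)) => k /= [[C1 C2] [C3 [mbad Hb]]].
apply: eps_sandwich C1 C2 C3 h1 h2 h3 h4 _ _.
  exact: (@sandwich_le _ _ _ (P k) _ _ _ x e a (mS k) (mJ k) mbad
    (fun w bw => (Hb w bw).1)).
exact: (@sandwich_ge _ _ _ (P k) _ _ _ x e a (mS k) (mJ k) mbad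
  (fun w bw => (Hb w bw).2)).
Qed.

End convergence.

(** * Algebra of the statistics *)

Section algebra.
Context {R : realType}.

Lemma sum_lt_sym m (F : 'I_m -> 'I_m -> R) : (forall i j, F i j = F j i) ->
  \sum_(i < m) \sum_(j < m | (i < j)%N) F i j =
  (\sum_(i < m) \sum_(j < m) F i j - \sum_(i < m) F i i) / 2.
Proof.
move=> Fsym.
have E : \sum_(i < m) \sum_(j < m) F i j =
    \sum_(i < m) \sum_(j < m | (i < j)%N) F i j +
    \sum_(i < m) \sum_(j < m | (j < i)%N) F i j + \sum_(i < m) F i i.
  rewrite -!big_split/=; apply: eq_bigr => i _.
  rewrite (bigD1 i)//= addrC; congr (_ + _).
  rewrite (bigID (fun j : 'I_m => (i < j)%N))/=; congr (_ + _); apply: eq_bigl => j.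
    by rewrite -val_eqE/=; case: ltngtP.
  by rewrite -val_eqE/=; case: ltngtP.
have S : \sum_(i < m) \sum_(j < m | (j < i)%N) F i j =
    \sum_(i < m) \sum_(j < m | (i < j)%N) F i j.
  rewrite (exchange_big_dep xpredT)//=; apply: eq_bigr => i _.
  by apply: eq_bigr => j _; exact: Fsym.
by rewrite E S; field.
Qed.

Lemma bin2R m : 'C(m, 2)%:R = m%:R * (m%:R - 1) / 2 :> R.
Proof.
elim: m => [|m IH]; first by rewrite bin0n mul0r mul0r.
by rewrite binS bin1 natrD IH -[m.+1%:R]natr1; field.
Qed.

Context {k : nat} (n : 'I_k -> nat).
Hypothesis n2 : forall i, (2 <= n i)%N.
Implicit Type y z : forall i : 'I_k, 'I_(n i) -> R.

Local Notation N := ((total_size n)%:R : R).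

(** Sum, sum of squares and normalised pair sum of a treatment. *)
Definition tsum y i : R := \sum_(j < n i) y i j.
Definition tsq y i : R := \sum_(j < n i) y i j ^+ 2.
Definition tpair y i : R := (tsum y i ^+ 2 - tsq y i) / 2 / ((n i)%:R - 1).

Lemma n_ge2 i : 2 <= (n i)%:R :> R.
Proof. by rewrite ler_nat. Qed.

Let n_neq0 i : (n i)%:R != 0 :> R.
Proof. by have := n_ge2 i; lra. Qed.

Let n1_neq0 i : (n i)%:R - 1 != 0 :> R.
Proof. by have := n_ge2 i; lra. Qed.

Lemma total_sizeE : N = \sum_(i < k) (n i)%:R.
Proof. by rewrite /total_size natr_sum. Qed.

Lemma sum_sqdiff y i i' : \sum_(j < n i) \sum_(j' < n i') (y i j - y i' j') ^+ 2 / 2 =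
  ((n i')%:R * tsq y i + (n i)%:R * tsq y i' - 2 * tsum y i * tsum y i') / 2.
Proof.
transitivity (\sum_(j < n i) ((n i')%:R / 2 * y i j ^+ 2 - tsum y i' * y i j
    + tsq y i' / 2)).
  apply: eq_bigr => j _.
  transitivity (\sum_(j' < n i') (y i j ^+ 2 / 2 - y i j * y i' j' +
      2^-1 * y i' j' ^+ 2)).
    by apply: eq_bigr => j' _; field.
  rewrite big_split/= sumrB -!mulr_sumr sumr_const card_ord -mulr_natr.
  by rewrite /tsum /tsq; field.
rewrite big_split/= sumrB -!mulr_sumr sumr_const card_ord -mulr_natr.
by rewrite /tsum /tsq; field.
Qed.

Lemma UwithinE y i : (n i)%:R * Uwithin y i = tsq y i - 2 * tpair y i.
Proof.
rewrite /Uwithin sum_lt_sym; last by move=> j j'; rewrite -sqrrN opprB.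
rewrite sum_sqdiff big1 ?subr0; last by move=> j _; rewrite subrr expr0n mul0r.
rewrite bin2R /tpair; field; rewrite n_neq0 n1_neq0//.
Qed.

Lemma WstatE y : (0 < k)%N ->
  Wstat y = (\sum_(i < k) tsq y i - 2 * \sum_(i < k) tpair y i) / N.
Proof.
move=> k0; rewrite /Wstat mulr_sumr -sumrB mulr_suml; apply: eq_bigr => i _.
by rewrite -UwithinE mulrAC.
Qed.

Lemma BstatE y : 1 < N ->
  'C(total_size n, 2)%:R * Bstat y =
  N * \sum_(i < k) tpair y i - \sum_(i < k) (n i)%:R * tpair y i -
  ((\sum_(i < k) tsum y i) ^+ 2 - \sum_(i < k) tsum y i ^+ 2) / 2.
Proof.
move=> N1; rewrite bin2R /Bstat mulr_sumr.
pose F (i i' : 'I_k) := (n i')%:R * tpair y i + (n i)%:R * tpair y i' -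
  tsum y i * tsum y i'.
transitivity (\sum_(i < k) \sum_(i' < k | (i < i')%N) F i i').
  apply: eq_bigr => i _; rewrite mulr_sumr; apply: eq_bigr => i' _.
  have U1 : Uwithin y i = (tsq y i - 2 * tpair y i) / (n i)%:R.
    by rewrite -UwithinE mulrC mulKf.
  have U2 : Uwithin y i' = (tsq y i' - 2 * tpair y i') / (n i')%:R.
    by rewrite -UwithinE mulrC mulKf.
  rewrite /Ubetween sum_sqdiff U1 U2 /F.
  field; rewrite !n_neq0/=; apply/andP; split; lra.
rewrite sum_lt_sym; last by move=> i j; rewrite /F; ring.
have -> : \sum_(i < k) \sum_(j < k) F i j =
    2 * (N * \sum_(i < k) tpair y i) - (\sum_(i < k) tsum y i) ^+ 2.
  transitivity (\sum_(i < k) (N * tpair y i + (n i)%:R * \sum_(j < k) tpair y j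
      - tsum y i * \sum_(j < k) tsum y j)).
    apply: eq_bigr => i _; rewrite sumrB big_split/=.
    by rewrite total_sizeE mulr_suml !mulr_sumr.
  by rewrite sumrB big_split/= -!mulr_suml -!mulr_sumr -total_sizeE; ring.
have -> : \sum_(i < k) F i i = 2 * \sum_(i < k) (n i)%:R * tpair y i -
    \sum_(i < k) tsum y i ^+ 2.
  by rewrite mulr_sumr -sumrB; apply: eq_bigr => i _; rewrite /F; ring.
by field.
Qed.

(** All the kernels depend on differences of observations only. *)
Lemma Jstat_shift c y z : (forall i j, y i j = c + z i j) -> Jstat y = Jstat z.
Proof.
move=> yz.
have D i j i' j' : y i j - y i' j' = z i j - z i' j' by rewrite !yz; ring.
have U i : Uwithin y i = Uwithin z i.
  congr (_ * _); apply: eq_bigr => j _; apply: eq_bigr => j' _.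
  by rewrite D.
have U' i i' : Ubetween y i i' = Ubetween z i i'.
  congr (_ * _); apply: eq_bigr => j _; apply: eq_bigr => j' _.
  by rewrite D.
rewrite /Jstat; congr (_ * _ / (_ * _)).
  by apply: eq_bigr => i _; apply: eq_bigr => i' _; rewrite !U U'.
by apply: eq_bigr => i _; rewrite U.
Qed.

(** A sum over the pooled sample of a function of the treatment. *)
Lemma big_sig1 (F : 'I_k -> R) :
  \sum_(r < \sum_(i < k) n i) F (tagnat.sig1 r) = \sum_(i < k) (n i)%:R * F i.
Proof.
rewrite (reindex (@tagnat.rank _ n))/=; last first.
  by exists (@tagnat.sig _ n) => p _; rewrite ?tagnat.rankK ?tagnat.sigK.
transitivity (\sum_(p : {i : 'I_k & 'I_(n i)}) F (tag p)).
  by apply: eq_bigr => p _; rewrite /tagnat.sig1 tagnat.rankK.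
transitivity (\sum_(i < k) \sum_(j < n i) F i).
  by rewrite (sig_big_dep xpredT (fun=> xpredT)).
by apply: eq_bigr => i _; rewrite sumr_const card_ord mulr_natl.
Qed.

Lemma MconstE : Mconst n = \sum_(i < k) (n i)%:R * (N - (n i)%:R) ^+ 2 / (2 * ((n i)%:R - 1))
  + (N ^+ 2 - \sum_(i < k) (n i)%:R ^+ 2) / 2 :> R.
Proof.
pose w (i i' : 'I_k) : R := if i == i' then
  ((N - (n i)%:R) / ((n i)%:R - 1)) ^+ 2 else 1.
have etaE (r s : 'I_(\sum_(i < k) n i)) : eta r s ^+ 2 = w (tagnat.sig1 r) (tagnat.sig1 s) :> R.
  by rewrite /eta /w; case: ifP => // _; rewrite sqrrN expr1n.
have wsym i i' : w i i' = w i' i.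
  by rewrite /w eq_sym; case: eqP => // ->.
transitivity (\sum_(r < \sum_(i < k) n i) \sum_(s < \sum_(i < k) n i | (r < s)%N)
    w (tagnat.sig1 r) (tagnat.sig1 s)).
  by apply: eq_bigr => r _; apply: eq_bigr => s _; exact: etaE.
rewrite sum_lt_sym; last by move=> r s; exact: wsym.
rewrite (big_sig1 (fun i => w i i)).
under eq_bigr => r _ do rewrite (big_sig1 (w (tagnat.sig1 r))).
rewrite (big_sig1 (fun i => \sum_(i' < k) (n i')%:R * w i i')).
have E i : \sum_(i' < k) (n i')%:R * w i i' =
    (N - (n i)%:R) + (n i)%:R * w i i.
  rewrite (bigD1 i)//= addrC; congr (_ + _).
  rewrite total_sizeE [in RHS](bigD1 i)//= addrAC subrr add0r.
  by apply: eq_bigr => i' ii'; rewrite /w eq_sym (negbTE ii') mulr1.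
under eq_bigr => i _ do rewrite E.
rewrite -sumrB mulr_suml.
have -> : N ^+ 2 = \sum_(i < k) N * (n i)%:R by rewrite -mulr_sumr -total_sizeE.
rewrite -sumrB mulr_suml -big_split/=; apply: eq_bigr => i _.
by rewrite /w eqxx; field; rewrite n1_neq0.
Qed.

(** The variance of the pair sum of treatment i, for errors of variance 1. *)
Definition pair_weight i : R := (n i)%:R / (2 * ((n i)%:R - 1)).

Lemma pair_weight_ge i : 2^-1 <= pair_weight i.
Proof.
have := n_ge2 i => h; rewrite /pair_weight ler_pdivlMr; last lra.
by rewrite mulrA mulVf ?mul1r ?pnatr_eq0//; lra.
Qed.

Lemma pair_weight_le i : pair_weight i <= 1.
Proof. by have := n_ge2 i => h; rewrite /pair_weight ler_pdivrMr; lra. Qed.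

(** The variance of the sum of the pair sums, for errors of variance 1. *)
Definition vtot : R := \sum_(i < k) pair_weight i.

Lemma vtot_ge : k%:R / 2 <= vtot.
Proof.
have : \sum_(i < k) (2^-1 : R) <= vtot.
  by apply: ler_sum => i _; exact: pair_weight_ge.
by rewrite sumr_const card_ord -[_ *+ k]mulr_natl.
Qed.

Lemma vtot_gt0 : (0 < k)%N -> 0 < vtot.
Proof.
by move=> k0; apply: lt_le_trans vtot_ge; rewrite divr_gt0// ltr0n.
Qed.

Lemma vtot_le : vtot <= k%:R.
Proof.
have : vtot <= \sum_(i < k) 1 by apply: ler_sum => i _; exact: pair_weight_le.
by rewrite sumr_const card_ord.
Qed.

Lemma total_size_ge : k%:R * 2 <= N.
Proof.
rewrite total_sizeE; apply: (@le_trans _ _ (\sum_(i < k) 2)).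
  by rewrite sumr_const card_ord mulr_natl.
by apply: ler_sum => i _; exact: n_ge2.
Qed.

(** M is asymptotically equivalent to N ^ 2 * vtot, the variance of N times the
    sum of the pair sums for errors of variance 1. *)
Lemma Mconst_near : `|Mconst n - N ^+ 2 * vtot| <= 3 * N ^+ 2.
Proof.
have nR := n_ge2.
have nN i : (n i)%:R <= N.
  by rewrite total_sizeE (bigD1 i)//= lerDl sumr_ge0.
have E : Mconst n - N ^+ 2 * vtot =
    \sum_(i < k) pair_weight i * (n i)%:R * ((n i)%:R - 2 * N) +
    (N ^+ 2 - \sum_(i < k) (n i)%:R ^+ 2) / 2.
  rewrite MconstE /vtot mulr_sumr addrAC -sumrB; congr (_ + _).
  apply: eq_bigr => i _; rewrite /pair_weight; field.
  by have := nR i; lra.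
have sq0 : 0 <= \sum_(i < k) ((n i)%:R : R) ^+ 2.
  by apply: sumr_ge0 => i _; exact: sqr_ge0.
have sqN : \sum_(i < k) ((n i)%:R : R) ^+ 2 <= N ^+ 2.
  rewrite [in leRHS]expr2 [X in X * _]total_sizeE mulr_suml.
  by apply: ler_sum => i _; rewrite expr2 ler_wpM2l.
have H : `|\sum_(i < k) pair_weight i * (n i)%:R * ((n i)%:R - 2 * N)| <= 2 * N ^+ 2.
  apply: le_trans (ler_norm_sum _ _ _) _.
  have -> : 2 * N ^+ 2 = \sum_(i < k) (n i)%:R * (2 * N).
    by rewrite -mulr_suml -total_sizeE; ring.
  apply: ler_sum => i _; have h1 := pair_weight_le i.
  have h2 := pair_weight_ge i.
  have h3 := nR i; have h4 := nN i.
  rewrite -mulrA normrM ger0_norm; last lra.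
  rewrite normrM ger0_norm; last lra.
  rewrite ltr0_norm; last lra.
  apply: (@le_trans _ _ (1 * ((n i)%:R * - ((n i)%:R - 2 * N)))).
    by rewrite ler_wpM2r//; apply: mulr_ge0; lra.
  by rewrite mul1r ler_wpM2l; lra.
rewrite E; apply: le_trans (ler_normD _ _) _.
have : `|(N ^+ 2 - \sum_(i < k) (n i)%:R ^+ 2) / 2| <= N ^+ 2.
  by have := sqr_ge0 N; rewrite ler_norml => ?; apply/andP; split; lra.
lra.
Qed.

End algebra.

(** * Moments of sums of pair products *)

Section fourth_powers.
Context {R : realType}.

Lemma exp4D_le (x y : R) : (x + y) ^+ 4 <= 8 * (x ^+ 4 + y ^+ 4).
Proof.
have := sqr_ge0 (x ^+ 2 - y ^+ 2); have := sqr_ge0 ((x - y) ^+ 2).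
have := sqr_ge0 ((x - y) * (x + y)); have := sqr_ge0 (x - y).
by have := sqr_ge0 (x + y); nra.
Qed.

(** Bounds on the fourth moments of a sum, respectively a sum of pair products,
    of m independent variables whose fourth moments are at most c. *)
Fixpoint sum4 (c : R) m : R := if m is m'.+1 then 8 * (sum4 c m' + c) else 0.
Fixpoint pair4 (c : R) m : R :=
  if m is m'.+1 then 8 * (pair4 c m' + c * sum4 c m') else 0.

Lemma sum4_ge0 c m : 0 <= c -> 0 <= sum4 c m.
Proof. by move=> c0; elim: m => //= m IH; rewrite mulr_ge0// addr_ge0. Qed.

Lemma pair4_ge0 c m : 0 <= c -> 0 <= pair4 c m.
Proof.
move=> c0; elim: m => //= m IH.
by rewrite mulr_ge0// addr_ge0// mulr_ge0// sum4_ge0.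
Qed.

Lemma pair4_nd c m p : 0 <= c -> (m <= p)%N -> pair4 c m <= pair4 c p.
Proof.
move=> c0 mp; rewrite -(subnKC mp); elim: (p - m)%N => [|q IH]; first by rewrite addn0.
rewrite addnS /=; apply: le_trans IH _.
have := pair4_ge0 (m + q) c0; have := sum4_ge0 (m + q) c0.
by move=> h1 h2; have := mulr_ge0 c0 h1; lra.
Qed.

End fourth_powers.

Section pair_products.
Context d (T : measurableType d) (R : realType) (P : probability T R).
Context (I : finType) (X : I -> {RV P >-> R}).
Hypothesis indX : mutually_independent X.
Variable V : nat -> {set I}.
Hypothesis dV : forall l m, (l < m)%N -> {in V l, forall i, i \notin V m}.
Variable xi : nat -> T -> R.
Hypothesis xiV : forall m, depends_on X (V m) (xi m).
Hypothesis xi0 : forall m, \int[P]_w xi m w = 0.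
Hypothesis ixi4 : forall m, integ P (fun w => xi m w ^+ 4).
Variables (s2 c4 : R).
Hypothesis xi4 : forall m, \int[P]_w (xi m w ^+ 4) <= c4.

Let xi_meas m : measurable_fun setT (xi m).
Proof. exact: depends_on_measurable (@xiV m). Qed.

Lemma integ_pow4 (f : T -> R) m : (m <= 4)%N -> measurable_fun setT f ->
  integ P (fun w => f w ^+ 4) -> integ P (fun w => f w ^+ m).
Proof.
move=> m4 mf F; apply: (integ_pow m4 mf).
by rewrite (_ : (fun w => _) = fun w => f w ^+ 4)//; apply/funext => w;
  rewrite -normrX ger0_norm// exprn_even_ge0.
Qed.

Let ixi m : integ P (xi m).
Proof. exact: (@integ_pow4 _ 1 isT (@xi_meas m) (@ixi4 m)). Qed.

Let ixi2 m : integ P (fun w => xi m w ^+ 2).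
Proof. exact: (@integ_pow4 _ 2 isT (@xi_meas m) (@ixi4 m)). Qed.

(** The sum of the products of the unordered pairs of distinct terms among the
    first m. *)
Definition pairsum m w : R := \sum_(l < m) psum xi l w * xi l w.

Lemma pairsumS m w : pairsum m.+1 w = pairsum m w + psum xi m w * xi m w.
Proof. by rewrite /pairsum big_ord_recr. Qed.

Lemma psumS m w : psum xi m.+1 w = psum xi m w + xi m w.
Proof. by rewrite /psum big_ord_recr. Qed.

Lemma pairsumE m w :
  pairsum m w = (psum xi m w ^+ 2 - \sum_(l < m) xi l w ^+ 2) / 2.
Proof.
elim: m => [|m IH]; first by rewrite /pairsum /psum !big_ord0 expr0n subrr mul0r.
by rewrite pairsumS IH psumS big_ord_recr/=; field.
Qed.

Lemma past_le l m : (l <= m)%N -> past V l \subset past V m.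
Proof.
move=> lm; apply/fintype.subsetP => i; rewrite !inE => /existsP[j ij].
by apply/existsP; exists (widen_ord lm j).
Qed.

Lemma depends_on_pairsum m : depends_on X (past V m) (pairsum m).
Proof.
apply: depends_on_sum => l _; apply: depends_onM.
  exact: (depends_on_subset (past_le (ltnW (ltn_ord l))) (@depends_on_psum _ _ _ _ _ _ _ _ xiV l)).
exact: depends_on_subset (sub_past _ (ltn_ord l)) (@xiV l).
Qed.

Let dep_psum m : depends_on X (past V m) (psum xi m).
Proof. exact: depends_on_psum. Qed.

Let depX U f j : depends_on X U f -> depends_on X U (fun w => f w ^+ j).
Proof. by move=> Uf; apply: (@depends_on_comp _ _ _ _ _ X U f (fun x => x ^+ j)). Qed.

Lemma psum4 m : integ P (fun w => psum xi m w ^+ 4) /\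
  \int[P]_w (psum xi m w ^+ 4) <= sum4 c4 m.
Proof.
elim: m => [|m [IH1 IH2]].
  rewrite (_ : (fun w => _) = fun=> 0).
    by split; [exact: integ_cst|rewrite mean_cst].
  by apply/funext => w; rewrite /psum big_ord0 expr0n.
have mS : measurable_fun setT (psum xi m.+1) by exact: depends_on_measurable (@dep_psum _).
have iB : integ P (fun w => 8 * (psum xi m w ^+ 4 + xi m w ^+ 4)).
  by apply: integZ; apply: integD.
have le4 w : psum xi m.+1 w ^+ 4 <= 8 * (psum xi m w ^+ 4 + xi m w ^+ 4).
  by rewrite psumS; exact: exp4D_le.
have iS : integ P (fun w => psum xi m.+1 w ^+ 4).
  apply: integ_le iB _; first exact: measurable_funX.
  by move=> w; rewrite ger0_norm ?exprn_even_ge0.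
split => //; apply: le_trans (mean_le iS iB le4) _.
rewrite meanZ; last exact: integD.
by rewrite meanD//= ler_wpM2l// lerD.
Qed.

Let ipsum m : integ P (psum xi m).
Proof.
apply: (@integ_pow4 _ 1) => //; last by case: (psum4 m).
exact: depends_on_measurable (@dep_psum _).
Qed.

Let ipsum2 m : integ P (fun w => psum xi m w ^+ 2).
Proof.
apply: (@integ_pow4 _ 2) => //; last by case: (psum4 m).
exact: depends_on_measurable (@dep_psum _).
Qed.

Lemma pairsum4 m : integ P (fun w => pairsum m w ^+ 4) /\
  \int[P]_w (pairsum m w ^+ 4) <= pair4 c4 m.
Proof.
elim: m => [|m [IH1 IH2]].
  rewrite (_ : (fun w => _) = fun=> 0).
    by split; [exact: integ_cst|rewrite mean_cst].
  by apply/funext => w; rewrite /pairsum big_ord0 expr0n.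
have [is4 le_s4] := psum4 m.
have [ip4 ep4] := past_mean indX dV (depX 4 (@dep_psum m))
  (depX 4 (@xiV m)) is4 (@ixi4 m).
have mS : measurable_fun setT (pairsum m.+1).
  exact: depends_on_measurable (@depends_on_pairsum _).
have iB : integ P (fun w => 8 * (pairsum m w ^+ 4 + psum xi m w ^+ 4 * xi m w ^+ 4)).
  by apply: integZ; apply: integD.
have le4 w : pairsum m.+1 w ^+ 4 <=
    8 * (pairsum m w ^+ 4 + psum xi m w ^+ 4 * xi m w ^+ 4).
  by rewrite pairsumS -exprMn; exact: exp4D_le.
have iS : integ P (fun w => pairsum m.+1 w ^+ 4).
  apply: integ_le iB _; first exact: measurable_funX.
  by move=> w; rewrite ger0_norm ?exprn_even_ge0.
split => //; apply: le_trans (mean_le iS iB le4) _.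
rewrite meanZ; last exact: integD.
rewrite meanD//= ler_wpM2l// lerD// ep4 mulrC ler_pM//.
- by apply: Rintegral_ge0 => w _; rewrite exprn_even_ge0.
- by apply: Rintegral_ge0 => w _; rewrite exprn_even_ge0.
Qed.

Let ipairsum2 m : integ P (fun w => pairsum m w ^+ 2).
Proof.
apply: (@integ_pow4 _ 2) => //; last by case: (pairsum4 m).
exact: depends_on_measurable (@depends_on_pairsum _).
Qed.

Lemma pairsum_mean m : \int[P]_w pairsum m w = 0.
Proof.
rewrite mean_sum => [|l _].
  rewrite big1// => l _.
  have [_ ->] := past_mean indX dV (@dep_psum l) (@xiV l) (ipsum l) (@ixi l).
  by rewrite xi0 mulr0.
by have [] := past_mean indX dV (@dep_psum l) (@xiV l) (ipsum l) (@ixi l).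
Qed.

(** The pair products are uncorrelated, and there are m * (m - 1) / 2 of them. *)
Lemma pairsum_var m : (forall l, (l < m)%N -> \int[P]_w (xi l w ^+ 2) = s2) ->
  \int[P]_w (pairsum m w ^+ 2) = s2 ^+ 2 * (m%:R * (m%:R - 1) / 2).
Proof.
elim: m => [|m IH] xi2.
  rewrite (eq_Rintegral _ (g := fun=> 0)); first by rewrite mean_cst !mul0r mulr0.
  by move=> w _; rewrite /pairsum big_ord0 expr0n.
have {}IH := IH (fun l lm => xi2 l (ltnW lm)).
have s2E : \int[P]_w (psum xi m w ^+ 2) = m%:R * s2.
  have [_ [_ ->]] := psum2 indX dV xiV xi0 ixi2 m.
  rewrite (eq_bigr (fun=> s2)); last by move=> l _; exact: (xi2 l (ltnW (ltn_ord l))).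
  by rewrite sumr_const card_ord mulr_natl.
have dTL : depends_on X (past V m) (fun w => pairsum m w * psum xi m w).
  exact: depends_onM (@depends_on_pairsum m) (@dep_psum m).
have iTL : integ P (fun w => pairsum m w * psum xi m w).
  apply: (@integ_le _ _ _ _ _ (fun w => pairsum m w ^+ 2 + psum xi m w ^+ 2)).
  - exact: depends_on_measurable dTL.
  - exact: integD.
  - move=> w; have := sqr_ge0 (pairsum m w - psum xi m w).
    have := sqr_ge0 (pairsum m w + psum xi m w).
    by rewrite ler_norml => h1 h2; apply/andP; split; nra.
have [j1 e1] := past_mean indX dV dTL (@xiV m) iTL (@ixi m).
have [j2 e2] := past_mean indX dV (depX 2 (@dep_psum m))
  (depX 2 (@xiV m)) (ipsum2 m) (@ixi2 m).
rewrite (eq_Rintegral _ (g := fun w => pairsum m w ^+ 2 +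
   (2 * (pairsum m w * psum xi m w * xi m w) + psum xi m w ^+ 2 * xi m w ^+ 2)));
   last by move=> w _; rewrite pairsumS; ring.
have iZ := integZ 2 j1.
rewrite (meanD (ipairsum2 m) (integD iZ j2)) (meanD iZ j2) (meanZ 2 j1) e1 e2.
rewrite IH s2E (xi2 m (leqnn _)) xi0 -natr1.
by field.
Qed.

End pair_products.

(** * Independent families indexed by ordinals *)

Section ordinal_families.
Context d (T : measurableType d) (R : realType) (P : probability T R).
Context (I : finType) (X : I -> {RV P >-> R}).
Hypothesis indX : mutually_independent X.
Context (p : nat) (W : 'I_p -> {set I}) (f : 'I_p -> T -> R).
Hypothesis dW : forall i j, i != j -> {in W i, forall u, u \notin W j}.
Hypothesis fW : forall i, depends_on X (W i) (f i).

(** Extension by zero of a family indexed by 'I_p to all natural numbers, and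
    the corresponding groups of variables, extended by the empty group. *)
Definition pad m : T -> R := oapp f (fun=> 0) (insub m).
Definition padset m : {set I} := oapp W finset.set0 (insub m).

Lemma pad_ord (i : 'I_p) : pad i = f i.
Proof. by rewrite /pad valK. Qed.

Lemma pad_ind (Q : (T -> R) -> Prop) : Q (fun=> 0) -> (forall i, Q (f i)) ->
  forall m, Q (pad m).
Proof. by move=> Q0 Qf m; rewrite /pad; case: insub => /=. Qed.

Lemma padset_disjoint l m : (l < m)%N ->
  {in padset l, forall u, u \notin padset m}.
Proof.
move=> lm u; rewrite /padset; case: insubP => [i _ il|_]; last by rewrite inE.
case: insubP => [j _ jm|_] /=; last by rewrite inE.
by apply: dW; rewrite -val_eqE il jm neq_ltn lm.
Qed.

Lemma depends_on_pad m : depends_on X (padset m) (pad m).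
Proof.
rewrite /pad /padset; case: insub => [i|] /=; first exact: fW.
exact: depends_on_cst.
Qed.

Lemma psum_pad w : psum pad p w = \sum_(i < p) f i w.
Proof. by apply: eq_bigr => i _; rewrite pad_ord. Qed.

Hypothesis f0 : forall i, \int[P]_w f i w = 0.

Lemma pad_mean m : \int[P]_w pad m w = 0.
Proof. by apply: (pad_ind (Q := fun g => \int[P]_w g w = 0)) => //; rewrite mean_cst. Qed.

Lemma sum_sqr_mean : (forall i, integ P (fun w => f i w ^+ 2)) ->
  integ P (fun w => (\sum_(i < p) f i w) ^+ 2) /\
  \int[P]_w ((\sum_(i < p) f i w) ^+ 2) = \sum_(i < p) \int[P]_w (f i w ^+ 2).
Proof.
move=> f2.
have pad2 m : integ P (fun w => pad m w ^+ 2).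
  apply: (pad_ind (Q := fun g => integ P (fun w => g w ^+ 2))) => //.
  exact: integ_cst.
have [_ [h1 h2]] := psum2 indX padset_disjoint depends_on_pad pad_mean pad2 p.
have E : psum pad p = fun w => \sum_(i < p) f i w.
  by apply/funext => w; exact: psum_pad.
rewrite E in h1 h2; split => //; rewrite h2; apply: eq_bigr => i _.
by rewrite pad_ord.
Qed.

Lemma pairsum_moments (s2 c4 : R) : 0 <= c4 ->
  (forall i, integ P (fun w => f i w ^+ 4)) ->
  (forall i, \int[P]_w (f i w ^+ 4) <= c4) ->
  (forall i, \int[P]_w (f i w ^+ 2) = s2) ->
  let g w := ((\sum_(i < p) f i w) ^+ 2 - \sum_(i < p) f i w ^+ 2) / 2 in
  [/\ \int[P]_w g w = 0, integ P (fun w => g w ^+ 4),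
      \int[P]_w (g w ^+ 4) <= pair4 c4 p &
      \int[P]_w (g w ^+ 2) = s2 ^+ 2 * (p%:R * (p%:R - 1) / 2)].
Proof.
move=> c40 f4 f4c f2 g.
have pad4 m : integ P (fun w => pad m w ^+ 4).
  apply: (pad_ind (Q := fun g => integ P (fun w => g w ^+ 4))) => //.
  exact: integ_cst.
have pad4c m : \int[P]_w (pad m w ^+ 4) <= c4.
  apply: (pad_ind (Q := fun g => \int[P]_w (g w ^+ 4) <= c4)) => //.
  by rewrite mean_cst expr0n.
have pad2 m : (m < p)%N -> \int[P]_w (pad m w ^+ 2) = s2.
  by move=> mp; rewrite -[m]/(val (Ordinal mp)) pad_ord.
have E : g = pairsum pad p.
  apply/funext => w; rewrite /g pairsumE psum_pad.
  by congr ((_ - _) / _); apply: eq_bigr => i _; rewrite pad_ord.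
rewrite E.
have [h1 h2] := pairsum4 indX padset_disjoint depends_on_pad pad4 pad4c p.
split => //.
- exact: (pairsum_mean indX padset_disjoint depends_on_pad pad_mean pad4 pad4c).
- exact: (pairsum_var indX padset_disjoint depends_on_pad pad_mean pad4 pad4c).
Qed.

Lemma sum_lindeberg (x0 a : R) : 0 < a ->
  (forall i, integ P (fun w => `|f i w| ^+ 3)) ->
  `|\int[P]_w heat x0 a 0 (\sum_(i < p) f i w) -
    Phi (x0 / Num.sqrt (a + \sum_(i < p) \int[P]_w (f i w ^+ 2)))|
  <= heat_bound a * \sum_(i < p)
       (\int[P]_w (`|f i w| ^+ 3) + (\int[P]_w (f i w ^+ 2)) ^+ 2).
Proof.
move=> a0 f3.
have pad3 m : integ P (fun w => `|pad m w| ^+ 3).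
  apply: (pad_ind (Q := fun g => integ P (fun w => `|g w| ^+ 3))) => //.
  exact: integ_cst.
have := lindeberg indX padset_disjoint depends_on_pad pad_mean pad3 p x0 a0.
rewrite (_ : psum pad p = fun w => \sum_(i < p) f i w); last first.
  by apply/funext => w; exact: psum_pad.
rewrite (eq_bigr (fun i : 'I_p => \int[P]_w (f i w ^+ 2))); last first.
  by move=> i _; rewrite pad_ord.
rewrite [X in heat_bound a * X](eq_bigr (fun i : 'I_p =>
   \int[P]_w (`|f i w| ^+ 3) + (\int[P]_w (f i w ^+ 2)) ^+ 2)) //.
by move=> i _; rewrite pad_ord.
Qed.

End ordinal_families.

(** * Moments of the layout *)

Section layout.
Context d (T : measurableType d) (R : realType) (P : probability T R).
Context (k : nat) (n : 'I_k -> nat) (b : 'I_k -> {RV P >-> R})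
  (e : forall i : 'I_k, 'I_(n i) -> {RV P >-> R}).
Variables (Nb : nat) (s2 c4 : R).
Arguments e : clear implicits.
Hypothesis indX : mutually_independent (effects_and_errors b e).
Hypothesis k0 : (0 < k)%N.
Hypothesis n2 : forall i, (2 <= n i <= Nb)%N.
Hypothesis s20 : 0 < s2.
Hypothesis e_mean : forall i j, \int[P]_w e i j w = 0.
Hypothesis e_var : forall i j, \int[P]_w (e i j w ^+ 2) = s2.
Hypothesis e_int4 : forall i j, integ P (fun w => e i j w ^+ 4).
Hypothesis e_mean4 : forall i j, \int[P]_w (e i j w ^+ 4) <= c4.

Local Notation X := (effects_and_errors b e).
Local Notation I := ('I_k + {i : 'I_k & 'I_(n i)})%type.
Local Notation N := ((total_size n)%:R : R).

(** The errors, as data of the layout. *)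
Definition errors w (i : 'I_k) (j : 'I_(n i)) : R := e i j w.

(** The variables indexing the errors of treatment i, respectively the error
    (i, j) alone; the treatment effects belong to no block. *)
Definition block (i : 'I_k) : {set I} :=
  [set u | if u is inr p then tag p == i else false]%SET.
Definition cell (i : 'I_k) (j : 'I_(n i)) : {set I} :=
  [set (inr (Tagged (fun i => 'I_(n i)) j) : I)]%SET.

Let n2' i : (2 <= n i)%N. Proof. by case/andP: (n2 i). Qed.

Let nR i : 2 <= (n i)%:R :> R. Proof. by rewrite ler_nat. Qed.

Lemma block_disjoint i j : i != j -> {in block i, forall u, u \notin block j}.
Proof.
by move=> ij [u|p]; rewrite !inE// => /eqP ->.
Qed.

Lemma cell_disjoint i (j j' : 'I_(n i)) : j != j' ->
  {in cell j, forall u, u \notin cell j'}.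
Proof.
move=> jj u; rewrite !inE => /eqP ->; apply: contra jj => /eqP[] /eqP.
by rewrite eq_Tagged/= => /eqP ->.
Qed.

Lemma depends_on_error i j : depends_on X (cell j) (e i j).
Proof.
exact: (@depends_on_var _ _ _ _ _ X (cell j) (inr (Tagged (fun i => 'I_(n i)) j)) (set11 _)).
Qed.

Lemma depends_on_block_error i j : depends_on X (block i) (e i j).
Proof.
apply: (@depends_on_var _ _ _ _ _ X (block i) (inr (Tagged (fun i => 'I_(n i)) j))).
by rewrite inE.
Qed.

Let depX U f j : depends_on X U f -> depends_on X U (fun w => f w ^+ j).
Proof. by move=> Uf; apply: (@depends_on_comp _ _ _ _ _ X U f (fun x => x ^+ j)). Qed.

(* pair sums, sums, and centred sums of squares of the treatments *)
Let Z i w : R := tpair (errors w) i.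
Let S i w : R := tsum (errors w) i.
Let Q i w : R := tsq (errors w) i - (n i)%:R * s2.

Lemma depends_on_tsum i : depends_on X (block i) (S i).
Proof. by apply: depends_on_sum => j _; exact: depends_on_block_error. Qed.

Lemma depends_on_tsq i : depends_on X (block i) (fun w => tsq (errors w) i).
Proof.
by apply: depends_on_sum => j _; apply: depX; exact: depends_on_block_error.
Qed.

Lemma depends_on_centered_tsq i : depends_on X (block i) (Q i).
Proof.
have h := @depends_on_tsq i.
have h' := @depends_on_cst _ _ _ _ _ X (block i) ((n i)%:R * s2).
exact (depends_onB h h').
Qed.

Lemma depends_on_tpair i : depends_on X (block i) (Z i).
Proof.
have := depX 2 (@depends_on_tsum i); have := @depends_on_tsq i => h1 h2.
apply: (@depends_onM _ _ _ _ _ X (block i) (fun w =>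
   (tsum (errors w) i ^+ 2 - tsq (errors w) i) / 2)); last exact: depends_on_cst.
apply: (@depends_onM _ _ _ _ _ X (block i) (fun w =>
   (tsum (errors w) i ^+ 2 - tsq (errors w) i))); last exact: depends_on_cst.
exact: depends_onB h2 h1.
Qed.

Let e_meas i j : measurable_fun setT (e i j).
Proof. exact: measurable_funPT. Qed.

Let e_int2 i j : integ P (fun w => e i j w ^+ 2).
Proof. exact: (@integ_pow4 _ _ _ _ _ 2 isT (@e_meas i j) (@e_int4 i j)). Qed.

Let e_int1 i j : integ P (e i j).
Proof. exact: (@integ_pow4 _ _ _ _ _ 1 isT (@e_meas i j) (@e_int4 i j)). Qed.

Let c40 : 0 <= c4.
Proof.
pose i0 := Ordinal k0; pose j0 := Ordinal (ltnW (n2' i0)).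
apply: le_trans _ (@e_mean4 i0 j0); apply: Rintegral_ge0 => w _.
by rewrite exprn_even_ge0.
Qed.

Lemma tsum_moments i : [/\ integ P (S i), \int[P]_w S i w = 0,
  integ P (fun w => S i w ^+ 2) & \int[P]_w (S i w ^+ 2) = (n i)%:R * s2].
Proof.
have [h1 h2] := sum_sqr_mean indX (@cell_disjoint i) (@depends_on_error i)
  (@e_mean i) (@e_int2 i).
split => //.
- by apply: integ_sum => j _; exact: e_int1.
- rewrite (@mean_sum _ _ _ P _ _ xpredT (fun j => e i j)) => [|j _].
    by apply: big1 => j _; exact: e_mean.
  exact: e_int1.
- rewrite h2 (eq_bigr (fun=> s2)) => [|j _]; last exact: e_var.
  by rewrite sumr_const card_ord mulr_natl.
Qed.

Lemma centered_tsq_moments i : [/\ \int[P]_w Q i w = 0,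
  integ P (fun w => Q i w ^+ 2) & \int[P]_w (Q i w ^+ 2) <= (n i)%:R * c4].
Proof.
pose g (j : 'I_(n i)) w := e i j w ^+ 2 - s2.
have QE : Q i = fun w => \sum_(j < n i) g j w.
  apply/funext => w; rewrite /Q /g sumrB sumr_const card_ord mulr_natl.
  by rewrite /tsq.
have dg j : depends_on X (cell j) (g j).
  apply: depends_onD; last exact: depends_on_cst.
  by apply: depX; exact: depends_on_error.
have ig j : integ P (g j) by apply: integB => //; exact: integ_cst.
have g0 j : \int[P]_w g j w = 0.
  by rewrite meanB// ?mean_cst ?e_var ?subrr//; exact: integ_cst.
have E j w : g j w ^+ 2 = e i j w ^+ 4 - (2 * s2 * e i j w ^+ 2 - s2 ^+ 2).
  by rewrite /g; ring.
have i2 j := integB (integZ (2 * s2) (@e_int2 i j)) (integ_cst P (s2 ^+ 2)).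
have g2 j : integ P (fun w => g j w ^+ 2).
  have := integB (@e_int4 i j) (i2 j); congr (integ _ _).
  by apply/funext => w; rewrite E.
have m2 j : \int[P]_w (g j w ^+ 2) <= c4.
  rewrite (eq_Rintegral _ (g := fun w => e i j w ^+ 4 - (2 * s2 * e i j w ^+ 2 - s2 ^+ 2)));
    last by move=> w _; exact: E.
  rewrite (meanB (@e_int4 i j) (i2 j)) (meanB (integZ _ (@e_int2 i j)) (integ_cst P _)).
  rewrite (meanZ _ (@e_int2 i j)) mean_cst e_var.
  by have := @e_mean4 i j; have := sqr_ge0 s2; lra.
have [h1 h2] := sum_sqr_mean indX (@cell_disjoint i) dg g0 g2.
rewrite QE; split => //.
- by rewrite mean_sum ?big1.
- rewrite h2; apply: le_trans (ler_sum _ (fun j _ => m2 j)) _.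
  by rewrite sumr_const card_ord mulr_natl.
Qed.

Local Notation wt := (@pair_weight R k n).
Local Notation v := (@vtot R k n).

Let wt_ge i : 2^-1 <= wt i. Proof. exact: pair_weight_ge. Qed.
Let wt_le i : wt i <= 1. Proof. exact: pair_weight_le. Qed.

Let C4 : R := pair4 c4 Nb.

Lemma tpair_moments i : [/\ \int[P]_w Z i w = 0, integ P (fun w => Z i w ^+ 4),
  \int[P]_w (Z i w ^+ 4) <= C4 &
  \int[P]_w (Z i w ^+ 2) = s2 ^+ 2 * wt i].
Proof.
have [h1 h2 h3 h4] := pairsum_moments indX (@cell_disjoint i)
  (@depends_on_error i) (@e_mean i) c40 (@e_int4 i) (@e_mean4 i) (@e_var i).
set g := (fun w => (_ - _) / 2) in h1 h2 h3 h4.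
have nn := nR i; pose c := ((n i)%:R - 1 : R)^-1.
have c0 : 0 <= c by rewrite invr_ge0; lra.
have c1 : c <= 1 by rewrite invf_le1; lra.
have ZE w : Z i w = c * g w by rewrite mulrC.
have mg : measurable_fun setT g.
  have -> : g = fun w => ((n i)%:R - 1) * Z i w.
    by apply/funext => w; rewrite ZE mulrA divff ?mul1r//; lra.
  apply: measurable_funM => //; exact: depends_on_measurable (@depends_on_tpair i).
have g1 : integ P g by exact: (@integ_pow4 _ _ _ _ _ 1 isT mg h2).
have E m : (fun w => Z i w ^+ m) = fun w => c ^+ m * g w ^+ m.
  by apply/funext => w; rewrite ZE exprMn.
have g2 : integ P (fun w => g w ^+ 2).
  exact: (@integ_pow4 _ _ _ _ _ 2 isT (integ_meas g1) h2).
split.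
- rewrite (eq_Rintegral _ (g := fun w => c * g w)); last by move=> w _; exact: ZE.
  by rewrite meanZ// h1 mulr0.
- by rewrite E; exact: integZ.
- rewrite E meanZ//; apply: (@le_trans _ _ (pair4 c4 (n i))).
    apply: le_trans _ h3; rewrite ler_piMl//; last exact: exprn_ile1.
    by apply: Rintegral_ge0 => w _; rewrite exprn_even_ge0.
  by apply: pair4_nd => //; case/andP: (n2 i).
- rewrite E meanZ// h4 /c /pair_weight; field; lra.
Qed.

Let N_gt1 : 1 < N.
Proof.
have : 1 <= k%:R :> R by rewrite ler1n.
have := @total_size_ge R k n n2'; lra.
Qed.

Let Z_int i m : (m <= 4)%N -> integ P (fun w => Z i w ^+ m).
Proof.
move=> m4; have [_ h _ _] := tpair_moments i.
by apply: (@integ_pow4 _ _ _ _ _ m m4 _ h); exact: depends_on_measurable (@depends_on_tpair i).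
Qed.

Lemma sum_tpair_moments : integ P (fun w => (\sum_(i < k) Z i w) ^+ 2) /\
  \int[P]_w ((\sum_(i < k) Z i w) ^+ 2) = s2 ^+ 2 * v.
Proof.
have Z0 i : \int[P]_w Z i w = 0 by case: (tpair_moments i).
have [h1 h2] := sum_sqr_mean indX block_disjoint (@depends_on_tpair) Z0 (fun i => @Z_int i 2 isT).
split => //; rewrite h2 mulr_sumr; apply: eq_bigr => i _.
by case: (tpair_moments i).
Qed.

Lemma sum_tsum_moments : integ P (fun w => (\sum_(i < k) S i w) ^+ 2) /\
  \int[P]_w ((\sum_(i < k) S i w) ^+ 2) = N * s2.
Proof.
have S0 i : \int[P]_w S i w = 0 by case: (tsum_moments i).
have S2 i : integ P (fun w => S i w ^+ 2) by case: (tsum_moments i).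
have [h1 h2] := sum_sqr_mean indX block_disjoint (@depends_on_tsum) S0 S2.
split => //; rewrite h2 total_sizeE mulr_suml; apply: eq_bigr => i _.
by case: (tsum_moments i).
Qed.

Lemma sum_tsq_moments : integ P (fun w => (\sum_(i < k) Q i w) ^+ 2) /\
  \int[P]_w ((\sum_(i < k) Q i w) ^+ 2) <= N * c4.
Proof.
have Q0 i : \int[P]_w Q i w = 0 by case: (centered_tsq_moments i).
have Q2 i : integ P (fun w => Q i w ^+ 2) by case: (centered_tsq_moments i).
have [h1 h2] := sum_sqr_mean indX block_disjoint (@depends_on_centered_tsq) Q0 Q2.
split => //; rewrite h2 total_sizeE mulr_suml; apply: ler_sum => i _.
by case: (centered_tsq_moments i).
Qed.

(** W is consistent for the error variance. *)
Lemma Wstat_moments : integ P (fun w => (Wstat (errors w) - s2) ^+ 2) /\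
  \int[P]_w ((Wstat (errors w) - s2) ^+ 2) <= (2 * c4 + 8 * s2 ^+ 2) / N.
Proof.
have [q1 q2] := sum_tsq_moments; have [z1 z2] := sum_tpair_moments.
have N0 : N != 0 by have := N_gt1; lra.
have E w : Wstat (errors w) - s2 =
    N^-1 * (\sum_(i < k) Q i w - 2 * \sum_(i < k) Z i w).
  rewrite (WstatE n2')// /Q /Z sumrB -mulr_suml -total_sizeE; field.
  by rewrite N0.
have mW : measurable_fun setT (fun w => Wstat (errors w) - s2).
  rewrite (_ : (fun w => _) = fun w => N^-1 * (\sum_(i < k) Q i w - 2 * \sum_(i < k) Z i w)); last first.
    by apply/funext => w; exact: E.
  apply: measurable_funM => //; apply: measurable_funB.
    by apply: measurable_sum => i; exact: depends_on_measurable (@depends_on_centered_tsq i).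
  apply: measurable_funM => //.
  by apply: measurable_sum => i; exact: depends_on_measurable (@depends_on_tpair i).
pose g w := N ^- 2 * (2 * (\sum_(i < k) Q i w) ^+ 2 + 8 * (\sum_(i < k) Z i w) ^+ 2).
have i2 := integZ 2 q1; have i8 := integZ 8 z1.
have ig : integ P g by apply: integZ; exact: integD.
have Wg w : (Wstat (errors w) - s2) ^+ 2 <= g w.
  rewrite E exprMn exprVn /g ler_wpM2l ?invr_ge0 ?sqr_ge0//.
  by have := sqr_ge0 (\sum_(i < k) Q i w + 2 * \sum_(i < k) Z i w); nra.
have iW : integ P (fun w => (Wstat (errors w) - s2) ^+ 2).
  apply: integ_le ig _; first exact: measurable_funX.
  by move=> w; rewrite ger0_norm ?sqr_ge0.
split => //; apply: le_trans (mean_le iW ig Wg) _.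
rewrite /g meanZ; last exact: integD.
rewrite (meanD i2 i8) (meanZ 2 q1) (meanZ 8 z1) z2.
have N1 := N_gt1; have vk := @vtot_le R k n n2'; have kN := @total_size_ge R k n n2'.
have v0 := @vtot_gt0 R k n n2' k0.
rewrite mulrC ler_pdivrMr ?exprn_gt0//; last lra.
have -> : (2 * c4 + 8 * s2 ^+ 2) / N * N ^+ 2 = (2 * c4 + 8 * s2 ^+ 2) * N by field.
have : s2 ^+ 2 * v <= s2 ^+ 2 * N by rewrite ler_wpM2l ?sqr_ge0//; lra.
lra.
Qed.

(** The part of the numerator that does not contribute to the limit. *)
Definition remainder w : R := 'C(total_size n, 2)%:R * Bstat (errors w) -
  N * \sum_(i < k) tpair (errors w) i.

Lemma remainder_mean : integ P (fun w => `|remainder w|) /\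
  \int[P]_w `|remainder w| <= N * (1 + s2 ^+ 2 + s2).
Proof.
have [m1 m2] := sum_tsum_moments.
have E w : remainder w = - (\sum_(i < k) (n i)%:R * Z i w) -
    ((\sum_(i < k) S i w) ^+ 2 - \sum_(i < k) S i w ^+ 2) / 2.
  rewrite /remainder (BstatE n2' _ N_gt1) /Z /S; ring.
have S2 i : integ P (fun w => S i w ^+ 2) by case: (tsum_moments i).
have dZ i := depends_on_measurable (@depends_on_tpair i).
have dS i := depends_on_measurable (@depends_on_tsum i).
have mr : measurable_fun setT remainder.
  rewrite (_ : remainder = fun w => - (\sum_(i < k) (n i)%:R * Z i w) -
    ((\sum_(i < k) S i w) ^+ 2 - \sum_(i < k) S i w ^+ 2) / 2); last first.
    by apply/funext => w; exact: E.
  apply: measurable_funB.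
    apply: measurableT_comp => //; apply: measurable_sum => i.
    by apply: measurable_funM => //; exact: dZ.
  apply: measurable_funM => //; apply: measurable_funB.
    by apply: measurable_funX; apply: measurable_sum => i; exact: dS.
  by apply: measurable_sum => i; apply: measurable_funX; exact: dS.
have iZ i : integ P (fun w => (n i)%:R * (1 + Z i w ^+ 2)).
  by apply: integZ; apply: integD; [exact: integ_cst|exact: Z_int].
have isZ := @integ_sum _ _ _ P _ (index_enum 'I_k) xpredT _ (fun i _ => iZ i).
have isS := @integ_sum _ _ _ P _ (index_enum 'I_k) xpredT _ (fun i _ => S2 i).
have iS := integD m1 isS.
pose g w := \sum_(i < k) (n i)%:R * (1 + Z i w ^+ 2) +
   2^-1 * ((\sum_(i < k) S i w) ^+ 2 + \sum_(i < k) S i w ^+ 2).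
have ig : integ P g by apply: integD => //; exact: integZ.
have rg w : `|remainder w| <= g w.
  rewrite E; apply: le_trans (ler_normB _ _) _; rewrite normrN; apply: lerD.
    apply: le_trans (ler_norm_sum _ _ _) _; apply: ler_sum => i _.
    rewrite normrM ger0_norm// ler_wpM2l//.
    have := sqr_ge0 (Z i w - 1); have := sqr_ge0 (Z i w + 1).
    by rewrite ler_norml => h1 h2; apply/andP; split; nra.
  rewrite mulrC normrM ger0_norm ?invr_ge0// ler_wpM2l ?invr_ge0//.
  have h1 := sqr_ge0 (\sum_(i < k) S i w).
  have h2 : 0 <= \sum_(i < k) S i w ^+ 2 by apply: sumr_ge0 => i _; exact: sqr_ge0.
  by rewrite ler_norml; apply/andP; split; lra.
have ir : integ P (fun w => `|remainder w|).
  apply: integ_le ig _; first exact: measurableT_comp.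
  by move=> w; rewrite normr_id.
split => //; apply: le_trans (mean_le ir ig rg) _.
rewrite (meanD isZ (integZ _ iS)) (meanZ _ iS) (meanD m1 isS) m2.
rewrite (mean_sum _ (fun i _ => iZ i)) (mean_sum _ (fun i _ => S2 i)).
have -> : \sum_(i < k) \int[P]_w (S i w ^+ 2) = N * s2.
  by rewrite total_sizeE mulr_suml; apply: eq_bigr => i _; case: (tsum_moments i).
have : \sum_(i < k) \int[P]_w ((n i)%:R * (1 + Z i w ^+ 2)) <=
    \sum_(i < k) (n i)%:R * (1 + s2 ^+ 2).
  apply: ler_sum => i _; have iz2 := @Z_int i 2 isT.
  rewrite (meanZ _ (integD (integ_cst P 1) iz2)) (meanD (integ_cst P 1) iz2) mean_cst.
  have [_ _ _ ->] := tpair_moments i.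
  by rewrite ler_wpM2l// lerD2l ler_piMr ?sqr_ge0 ?wt_le.
rewrite -mulr_suml -total_sizeE; lra.
Qed.

(** The sum of the pair sums, scaled to variance 1. *)
Definition leading w : R := \sum_(i < k) (s2 * Num.sqrt v)^-1 * tpair (errors w) i.

Lemma measurable_leading : measurable_fun setT leading.
Proof.
apply: measurable_sum => i; apply: measurable_funM => //.
exact: depends_on_measurable (@depends_on_tpair i).
Qed.

(** Lindeberg's bound for the leading term: the third absolute moments of its k
    summands are O(v ^ (- 3 / 2)), their squared variances sum to at most 1 / v. *)
Lemma leading_heat (x0 a : R) : 0 < a ->
  `|\int[P]_w heat x0 a 0 (leading w) - Phi (x0 / Num.sqrt (a + 1))| <=
  heat_bound a * (2 * (1 + C4) * s2^-1 ^+ 3 * (Num.sqrt v)^-1 + v^-1).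
Proof.
move=> a0; pose u := (Num.sqrt v)^-1; pose c := (s2 * Num.sqrt v)^-1.
have v0 := @vtot_gt0 R k n n2' k0.
have u0 : 0 < u by rewrite invr_gt0 sqrtr_gt0.
have u2 : u ^+ 2 = v^-1 by rewrite exprVn sqr_sqrtr// ltW.
have cE : c = s2^-1 * u by rewrite /c invfM.
have c0 : 0 <= c by rewrite cE; apply: mulr_ge0; [rewrite invr_ge0; exact: ltW|exact: ltW].
pose f i w := c * Z i w.
have df i : depends_on X (block i) (f i).
  have h := @depends_on_cst _ _ _ _ _ X (block i) c.
  exact (depends_onM h (@depends_on_tpair i)).
have iZ i : integ P (Z i) by exact: (@Z_int i 1 isT).
have f0 i : \int[P]_w f i w = 0.
  by rewrite (meanZ _ (iZ i)); case: (tpair_moments i) => -> _ _ _; rewrite mulr0.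
have fn i w : `|f i w| ^+ 3 <= c ^+ 3 * (1 + Z i w ^+ 4).
  rewrite normrM (ger0_norm c0) exprMn ler_wpM2l ?exprn_ge0//.
  have := @ler_normX _ (Z i w) 3 4 isT.
  by rewrite -[X in _ <= _ + X]normrX (ger0_norm (exprn_even_ge0 _ _)).
have iB i : integ P (fun w => c ^+ 3 * (1 + Z i w ^+ 4)).
  by apply: integZ; apply: integD; [exact: integ_cst|exact: Z_int].
have f3 i : integ P (fun w => `|f i w| ^+ 3).
  apply: integ_le (iB i) _.
    apply: measurable_funX; apply: measurableT_comp => //.
    exact: depends_on_measurable (df i).
  by move=> w; rewrite ger0_norm ?exprn_ge0.
have f3m i : \int[P]_w (`|f i w| ^+ 3) <= c ^+ 3 * (1 + C4).
  apply: le_trans (mean_le (f3 i) (iB i) (fn i)) _.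
  have iz4 := @Z_int i 4 isT.
  rewrite (meanZ _ (integD (integ_cst P 1) iz4)) (meanD (integ_cst P 1) iz4) mean_cst.
  by rewrite ler_wpM2l ?exprn_ge0// lerD2l; case: (tpair_moments i).
have f2m i : \int[P]_w (f i w ^+ 2) = wt i * v^-1.
  rewrite (eq_Rintegral _ (g := fun w => c ^+ 2 * Z i w ^+ 2)); last first.
    by move=> w _; rewrite exprMn.
  rewrite (meanZ _ (@Z_int i 2 isT)); have [_ _ _ ->] := tpair_moments i.
  by rewrite cE exprMn u2; field; rewrite !gt_eqF.
have := sum_lindeberg indX block_disjoint df f0 x0 a0 f3.
have -> : \sum_(i < k) \int[P]_w (f i w ^+ 2) = 1.
  under eq_bigr do rewrite f2m.
  by rewrite -mulr_suml divff// gt_eqF.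
move=> h; apply: le_trans h _.
have B0 := heat_bound_ge0 a.
rewrite ler_wpM2l// big_split/= lerD//.
  apply: le_trans (ler_sum _ (fun i _ => f3m i)) _.
  rewrite sumr_const card_ord -[_ *+ k]mulr_natl.
  have hv := @vtot_ge R k n n2'; rewrite -[(Num.sqrt v)^-1]/u.
  have C40 : 0 <= C4 by exact: pair4_ge0.
  have -> : 2 * (1 + C4) * s2^-1 ^+ 3 * u = (2 * v) * (c ^+ 3 * (1 + C4)).
    have -> : c ^+ 3 = s2^-1 ^+ 3 * (u * u ^+ 2) by rewrite cE; ring.
    by rewrite u2; field; rewrite !gt_eqF.
  rewrite ler_wpM2r//; last lra.
  by rewrite mulr_ge0 ?exprn_ge0//; lra.
rewrite -[leRHS]mul1r -[X in X * _](@divff _ v) ?gt_eqF// [v in X in X / _](_ : _ = \sum_(i < k) wt i)// -mulrA mulr_suml.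
apply: ler_sum => i _; rewrite f2m exprMn -expr2 ler_wpM2r ?sqr_ge0//.
have := wt_le i; have := wt_ge i; nra.
Qed.

End layout.

(** * Comparison of the statistic with its leading term *)

Section slutsky.
Context {R : realType}.

(** If A + D <= x * W * m, where m and W are close to N * t and s, then
    A / (N * s * t) is at most x up to a small error, and conversely. *)
Lemma ratio_sandwich (x eps q A D W m N s t : R) :
  0 < N -> 0 < s -> 0 < t -> 0 <= q -> q <= 2^-1 -> 0 <= m ->
  3 * q * `|x| <= eps / 2 -> `|W - s| < q * s -> `|m / (N * t) - 1| <= q ->
  `|D| < eps / 2 * (N * s * t) ->
  ((A + D) / (W * m) <= x -> A / (N * s * t) <= x + eps) /\
  (A / (N * s * t) <= x - eps -> (A + D) / (W * m) <= x).
Proof.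
move=> N0 s0 t0 q0 q2 m0 xq Ws mN Dr.
pose w := W / s; pose u := m / (N * t).
have Nt0 : 0 < N * t by rewrite mulr_gt0.
have Nst : 0 < N * s * t by rewrite !mulr_gt0.
have w1 : `|w - 1| <= q.
  have -> : w - 1 = (W - s) / s by rewrite /w; field; rewrite gt_eqF.
  by rewrite normrM normfV (gtr0_norm s0) ler_pdivrMr// ltW.
have WE : W = w * s by rewrite /w divfK// gt_eqF.
have mE : m = u * (N * t) by rewrite /u divfK// gt_eqF.
have w0 : 0 < w by move: w1; rewrite ler_norml; lra.
have u0 : 0 < u by move: mN; rewrite -/u ler_norml; lra.
have wu : `|x * (w * u) - x| <= eps / 2.
  have -> : x * (w * u) - x = x * (w * (u - 1) + (w - 1)) by ring.
  rewrite normrM; apply: le_trans xq; rewrite mulrC ler_wpM2r//.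
  apply: le_trans (ler_normD _ _) _.
  have h : `|w * (u - 1)| <= 2 * q.
    rewrite normrM (gtr0_norm w0) ler_pM// ?ltW//.
    by move: w1; rewrite ler_norml; lra.
  by move: w1; rewrite /u; lra.
pose r := D / (N * s * t).
have r2 : `|r| < eps / 2.
  by rewrite normrM normfV (gtr0_norm Nst) ltr_pdivrMr.
have key : ((A + D) / (W * m) <= x) = (A / (N * s * t) + r <= x * (w * u)).
  have -> : W * m = (w * u) * (N * s * t) by rewrite WE mE; ring.
  rewrite ler_pdivrMr; last exact: (mulr_gt0 (mulr_gt0 w0 u0) Nst).
  rewrite -[RHS](ler_pM2r Nst); congr (_ <= _); last by rewrite !mulrA.
  by rewrite /r -mulrDl divfK// gt_eqF.
move: wu r2; rewrite key ler_norml ltr_norml => wu r2.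
by split => ?; lra.
Qed.

End slutsky.

Section layout_comparison.
Context d (T : measurableType d) (R : realType) (P : probability T R).
Context (k : nat) (n : 'I_k -> nat) (mu : R) (b : 'I_k -> {RV P >-> R})
  (e : forall i : 'I_k, 'I_(n i) -> {RV P >-> R}).
Arguments e : clear implicits.
Variables (Nb : nat) (s2 c4 : R).
Hypothesis indX : mutually_independent (effects_and_errors b e).
Hypothesis k0 : (0 < k)%N.
Hypothesis n2 : forall i, (2 <= n i <= Nb)%N.
Hypothesis s20 : 0 < s2.
Hypothesis e_mean : forall i j, \int[P]_w e i j w = 0.
Hypothesis e_var : forall i j, \int[P]_w (e i j w ^+ 2) = s2.
Hypothesis e_int4 : forall i j, integ P (fun w => e i j w ^+ 4).
Hypothesis e_mean4 : forall i j, \int[P]_w (e i j w ^+ 4) <= c4.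
Hypothesis b_null : forall i, P [set w | b i w != 0] = 0%E.

Local Notation N := ((total_size n)%:R : R).
Local Notation v := (@vtot R k n).

Let n2' i : (2 <= n i)%N. Proof. by case/andP: (n2 i). Qed.

(** Some treatment effect is not zero. *)
Definition nonzero_effect : set T := \big[setU/set0]_(i < k) [set w | b i w != 0].

Lemma nonzero_effect0 : measurable nonzero_effect /\ P nonzero_effect = 0%E.
Proof.
rewrite /nonzero_effect; elim/big_ind : _ => [|A B [mA A0] [mB B0]|i _].
- by split => //; rewrite measure0.
- split; first exact: measurableU.
  apply/eqP; rewrite eq_le measure_ge0 andbT.
  apply: le_trans (measureU2 _ mA mB) _.
  by rewrite [X in (X + _)%E](_ : _ = 0%E)// [X in (_ + X)%E](_ : _ = 0%E)// adde0.
- by split; [exact/measurable_neq0/measurable_funPT|exact: b_null].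
Qed.

(** A treatment effect is not zero, or W is far from s2, or the remainder is
    not negligible; outside this event the statistic and its leading term are
    comparable. *)
Definition bad_event (q eps : R) : set T := nonzero_effect `|`
  ([set w | (q * s2) ^+ 2 <= (Wstat (errors e w) - s2) ^+ 2] `|`
   [set w | eps / 2 * (N * s2 * Num.sqrt v) <= `|remainder e w|]).

Let Wm := Wstat_moments indX k0 n2 e_mean e_var e_int4 e_mean4.
Let rm := remainder_mean indX k0 n2 e_mean e_var e_int4 e_mean4.

Lemma measurable_bad q eps : measurable (bad_event q eps).
Proof.
apply: measurableU; first by case: nonzero_effect0.
have [[W1 _] [r1 _]] := (Wm, rm).
by apply: measurableU; [exact: measurable_ge (integ_meas W1)|exact: measurable_ge (integ_meas r1)].
Qed.

Let fine_U2 (A B : set T) : measurable A -> measurable B ->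
  fine (P (A `|` B)) <= fine (P A) + fine (P B).
Proof.
move=> mA mB; rewrite -fineD ?fin_num_measure//.
apply: fine_le; rewrite ?fin_numD ?fin_num_measure//; last exact: measureU2.
exact: measurableU.
Qed.

Lemma bad_event_le q eps : 0 < q -> 0 < eps -> fine (P (bad_event q eps)) <=
  (2 * c4 + 8 * s2 ^+ 2) / N / (q * s2) ^+ 2 +
  (1 + s2 ^+ 2 + s2) / (eps / 2 * s2) * (Num.sqrt v)^-1.
Proof.
move=> q0 eps0; have [W1 W2] := Wm; have [r1 r2] := rm.
have v0 := @vtot_gt0 R k n n2' k0.
have sv0 : 0 < Num.sqrt v by rewrite sqrtr_gt0.
have N0 : 0 < N.
  have := @total_size_ge R k n n2'; have : 0 < k%:R :> R by rewrite ltr0n.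
  lra.
have [mb b0] := nonzero_effect0.
have m1 := measurable_ge ((q * s2) ^+ 2) (integ_meas W1).
have m2 := measurable_ge (eps / 2 * (N * s2 * Num.sqrt v)) (integ_meas r1).
apply: le_trans (fine_U2 mb (measurableU _ _ m1 m2)) _.
rewrite b0 add0r; apply: le_trans (fine_U2 m1 m2) _; apply: lerD.
  apply: le_trans (markov_mean _ _ W1) _.
  - by rewrite exprn_gt0// mulr_gt0.
  - by move=> w; rewrite sqr_ge0.
  - by rewrite ler_wpM2r// invr_ge0 sqr_ge0.
apply: le_trans (markov_mean _ _ r1) _ => //.
  by rewrite mulr_gt0 ?divr_gt0// !mulr_gt0.
apply: le_trans (ler_wpM2r _ r2) _.
  by rewrite invr_ge0 mulr_ge0 ?divr_ge0 ?mulr_ge0// ltW.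
rewrite le_eqVlt; apply/orP; left; apply/eqP; field.
by rewrite !gt_eqF.
Qed.

Lemma bad_event_sandwich x q eps : 0 < q -> q <= 2^-1 ->
  3 * q * `|x| <= eps / 2 -> 3 / v <= q ->
  forall w, ~ bad_event q eps w ->
  (Jresponse mu b e w <= x -> leading e s2 w <= x + eps) /\
  (leading e s2 w <= x - eps -> Jresponse mu b e w <= x).
Proof.
move=> q0 q2 xq vq w /not_orP[bw /not_orP[/negP Ww /negP Rw]].
have v0 := @vtot_gt0 R k n n2' k0.
have sv0 : 0 < Num.sqrt v by rewrite sqrtr_gt0.
have N0 : 0 < N.
  have := @total_size_ge R k n n2'; have : 0 < k%:R :> R by rewrite ltr0n.
  lra.
have bw0 i : b i w = 0.
  apply/eqP; apply: contrapT => /negP biw; apply: bw.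
  by rewrite /nonzero_effect (bigD1 i)//=; left.
have -> : Jresponse mu b e w = Jstat (errors e w).
  by apply: (@Jstat_shift _ _ _ mu) => i j; rewrite /response bw0 addr0.
have -> : leading e s2 w =
    (N * \sum_(i < k) tpair (errors e w) i) / (N * s2 * Num.sqrt v).
  by rewrite /leading -mulr_sumr; field; rewrite !gt_eqF.
have -> : Jstat (errors e w) = (N * \sum_(i < k) tpair (errors e w) i +
    remainder e w) / (Wstat (errors e w) * Num.sqrt (Mconst n)).
  by rewrite /Jstat /remainder addrCA subrr addr0.
have Mv := @Mconst_near R k n n2'.
have N2 : 0 < N ^+ 2 by rewrite exprn_gt0.
have near1 : `|Mconst n / (N ^+ 2 * v) - 1| <= q.
  apply: le_trans vq.
  have -> : Mconst n / (N ^+ 2 * v) - 1 = (Mconst n - N ^+ 2 * v) / (N ^+ 2 * v).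
    by field; rewrite !gt_eqF.
  rewrite normrM normfV (gtr0_norm (mulr_gt0 N2 v0)) ler_pdivrMr ?mulr_gt0//.
  apply: le_trans Mv _; rewrite le_eqVlt; apply/orP; left; apply/eqP.
  by field; rewrite gt_eqF.
apply: (@ratio_sandwich R x eps q) => //.
- exact: ltW.
- rewrite ltNge; apply/negP => h; move/negP: Ww; apply.
  rewrite -[leRHS]real_normK ?num_real//.
  by apply: lerXn2r; rewrite ?nnegrE ?mulr_ge0// ltW.
- pose u := Num.sqrt (Mconst n) / (N * Num.sqrt v).
  have u0 : 0 <= u by rewrite divr_ge0// mulr_ge0// ltW.
  have M0 : 0 <= Mconst n :> R.
    by apply: sumr_ge0 => r _; apply: sumr_ge0 => s _; exact: sqr_ge0.
  have u2 : u ^+ 2 = Mconst n / (N ^+ 2 * v).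
    by rewrite /u exprMn exprVn exprMn !sqr_sqrtr// ltW.
  apply: le_trans near1; rewrite -u2.
  have -> : u ^+ 2 - 1 = (u - 1) * (u + 1) by ring.
  rewrite normrM [`|u + 1|]ger0_norm; last lra.
  by rewrite ler_peMr//; lra.
- by rewrite ltNge.
Qed.

End layout_comparison.

(** * Moments of the model, and the conclusion *)

Section moments_of_model.
Context d (T : measurableType d) (R : realType) (P : probability T R).
Implicit Type X : {RV P >-> R}.

Lemma Rintegral_of_expectation (X : T -> R) r :
  'E_P[X]%E = r%:E -> \int[P]_w X w = r.
Proof. by rewrite unlock /Rintegral => ->. Qed.

Lemma centered_varianceE X : 'E_P[X]%E = 0%E ->
  'V_P[X]%E = (\int[P]_w (X w ^+ 2)%:E)%E.
Proof.
move=> X0; rewrite /variance unlock X0 unlock; apply: eq_integral => w _ /=.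
by rewrite -[LHS]/(((X w - 0) * (X w - 0))%:E) subr0 expr2.
Qed.

(** A centred variable of variance 0 vanishes almost surely. *)
Lemma null_of_variance0 X : 'E_P[X]%E = 0%E -> 'V_P[X]%E = 0%E ->
  P [set w | X w != 0] = 0%E.
Proof.
move=> X0; rewrite centered_varianceE// => V0.
have mX2 : measurable_fun setT (fun w => (X w ^+ 2)%:E).
  by apply/measurable_EFinP; apply: measurable_funX; exact: measurable_funPT.
have mA := measurable_neq0 (@measurable_funPT _ _ _ _ X).
have /(ae_eq_integral_abs P measurableT mX2) : (\int[P]_w `|(X w ^+ 2)%:E| = 0)%E.
  by rewrite -V0; apply: eq_integral => w _; rewrite /= ger0_norm ?sqr_ge0.
move=> [N [mN N0 sub]]; apply/eqP; rewrite eq_le measure_ge0 andbT.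
have XN : [set w | X w != 0] `<=` N.
  move=> w /= Xw; apply: sub => /= /(_ Logic.I) [] /eqP.
  by rewrite sqrf_eq0 (negbTE Xw).
by rewrite -N0; apply: le_measure; rewrite ?inE.
Qed.

Lemma integ_fourth X : ('E_P[(fun w => X w ^+ 4)%R] < +oo)%E ->
  integ P (fun w => X w ^+ 4).
Proof.
rewrite unlock => X4; apply/integrableP; split.
  by apply/measurable_EFinP; apply: measurable_funX; exact: measurable_funPT.
rewrite (eq_integral (fun w => (X w ^+ 4)%:E))// => w _.
by rewrite /= ger0_norm// exprn_even_ge0.
Qed.

End moments_of_model.

Lemma mean_identically_distributed d d' (T : measurableType d)
    (T' : measurableType d') (R : realType) (P : probability T R)
    (P' : probability T' R) (X : {RV P >-> R}) (X' : {RV P' >-> R}) (f : R -> R) :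
  identically_distributed X X' -> measurable_fun setT f -> (forall x, 0 <= f x) ->
  \int[P]_w f (X w) = \int[P']_w f (X' w).
Proof.
move=> XX' mf f0; rewrite /Rintegral; congr fine.
have mf' : measurable_fun setT (EFin \o f) by exact/measurable_EFinP.
have f0' y : (0 <= (EFin \o f) y)%E by rewrite /= lee_fin.
have := ge0_integral_distribution X mf' f0'.
have := ge0_integral_distribution X' mf' f0' => /= <- <-.
by apply: eq_measure_integral => A mA _; exact: XX'.
Qed.

Section rate.
Context {R : realType}.

(** A null sequence that dominates the inverses of v, of the square root of v
    and of the total size. *)
Definition rate k : R := Num.sqrt (2 / k%:R).

Lemma rate_ge0 k : 0 <= rate k. Proof. exact: sqrtr_ge0. Qed.

Lemma cvg_rate : rate k @[k --> \oo] --> (0 : R).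
Proof.
apply/cvgrPdist_le => eps eps0.
have e4 : 0 < eps ^+ 2 / 4 by rewrite divr_gt0// exprn_gt0.
have /cvgrPdist_le /(_ _ e4) h := @cvg_harmonic R.
near=> k; have k1 : (1 <= k)%N by near: k; exact: nbhs_infty_ge.
have kR : 1 <= k%:R :> R by rewrite ler1n.
have : `|0 - harmonic k| <= eps ^+ 2 / 4 by near: k; exact: h.
rewrite !sub0r !normrN (ger0_norm (rate_ge0 k)) /harmonic/= ger0_norm// => hk.
rewrite -(ger0_norm (ltW eps0)) -sqrtr_sqr ler_wsqrtr// ler_pdivrMr; last lra.
move: hk; rewrite -[leLHS]div1r ler_pdivrMr; last by rewrite ltr0n.
have hp : 0 <= eps ^+ 2 * (k%:R - 1) by rewrite mulr_ge0 ?sqr_ge0//; lra.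
rewrite -[k.+1%:R]natr1; lra.
Unshelve. all: by end_near. Qed.

Lemma cvg_of_rate (f : nat -> R) l C :
  (forall k, (2 <= k)%N -> `|f k - l| <= C * rate k) -> f k @[k --> \oo] --> l.
Proof.
move=> fC; apply/cvgrPdist_le => eps eps0.
have : C * rate k @[k --> \oo] --> (C * 0 : R) by apply: cvgMl_tmp; exact: cvg_rate.
rewrite mulr0 => /cvgrPdist_le /(_ _ eps0) h.
near=> k; rewrite distrC; apply: (@le_trans _ _ (C * rate k)).
  by apply: fC; near: k; exact: nbhs_infty_ge.
have : `|0 - C * rate k| <= eps by near: k; exact: h.
by rewrite sub0r normrN; apply: le_trans; exact: ler_norm.
Unshelve. all: by end_near. Qed.

Context (k : nat) (n : 'I_k -> nat).
Hypothesis n2 : forall i, (2 <= n i)%N.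
Hypothesis k2 : (2 <= k)%N.

Lemma rate_sqr : rate k ^+ 2 = 2 / k%:R :> R.
Proof. by rewrite sqr_sqrtr// divr_ge0. Qed.

Lemma rate_sqr_le : 2 / k%:R <= rate k :> R.
Proof.
have kR : 2 <= k%:R :> R by rewrite ler_nat.
have : rate k ^+ 2 <= 1 by rewrite rate_sqr ler_pdivrMr; lra.
by rewrite -rate_sqr; have := rate_ge0 k; nra.
Qed.

Let kR0 : 0 < k%:R :> R. Proof. by rewrite ltr0n ltnW. Qed.
Let v0 : 0 < vtot n :> R. Proof. by apply: vtot_gt0 => //; exact: ltnW. Qed.

Lemma inv_vtot_le : (vtot n)^-1 <= 2 / k%:R :> R.
Proof.
have kR := kR0; have hv := @vtot_ge R k n n2.
rewrite -div1r ler_pdivrMr ?v0// mulrAC ler_pdivlMr ?kR0//; lra.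
Qed.

Lemma inv_vtot_rate : (vtot n)^-1 <= rate k :> R.
Proof. exact: le_trans inv_vtot_le rate_sqr_le. Qed.

Lemma inv_sqrt_vtot_rate : (Num.sqrt (vtot n))^-1 <= rate k :> R.
Proof.
rewrite -sqrtrV; last exact: ltW v0.
by apply: ler_wsqrtr; exact: inv_vtot_le.
Qed.

Lemma inv_total_size_rate : ((total_size n)%:R)^-1 <= rate k :> R.
Proof.
have kR := kR0; have kN := @total_size_ge R k n n2.
apply: le_trans _ rate_sqr_le.
rewrite -div1r ler_pdivrMr; last lra.
by rewrite mulrAC ler_pdivlMr ?kR0//; lra.
Qed.

End rate.

Theorem mainTheorem1 (R : realType) (d : nat -> measure_display)
  (T : forall k : nat, measurableType (d k))
  (P : forall k : nat, probability (T k) R)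
  (n : forall k : nat, 'I_k -> nat) (N : nat) (mu sb2 se2 : R)
  (b : forall k : nat, 'I_k -> {RV (P k) >-> R})
  (e : forall (k : nat) (i : 'I_k), 'I_(n k i) -> {RV (P k) >-> R})
  (hmodel : forall k, random_effects_model (b k) (e k) sb2 se2)
  (hlaw : forall k i j k' i' j', identically_distributed (e k i j) (e k' i' j'))
  (hmoment : forall k i j, ('E_(P k)[(fun w => e k i j w ^+ 4)%R] < +oo)%E)
  (hnull : sb2 = 0)
  (hbounded : forall k i, (2 <= n k i <= N)%N) :
  converges_in_distribution (fun k => Jn mu (b k) (e k)) (normal_prob 0 1).
Proof.
have s20 : 0 < se2 by case: (hmodel 0%N).
have indX k : mutually_independent (effects_and_errors (b k) (e k)).
  by case: (hmodel k).
have e_mean k i j : \int[P k]_w e k i j w = 0.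
  by apply: Rintegral_of_expectation; case: (hmodel k).
have e_int4 k i j : integ (P k) (fun w => e k i j w ^+ 4).
  exact/integ_fourth/hmoment.
have e_var k i j : \int[P k]_w (e k i j w ^+ 2) = se2.
  have [_ _ _ _ _ _ _ _ m0 mv] := hmodel k.
  have := mv i j; rewrite centered_varianceE; last exact: m0.
  by rewrite /Rintegral => ->.
have b_null k i : P k [set w | b k i w != 0] = 0%E.
  have [_ _ _ _ _ m0 mv _ _ _] := hmodel k.
  by apply: null_of_variance0; rewrite ?m0// mv hnull.
(* a reference error, in the layout with one treatment *)
pose j0 : 'I_(n 1%N ord0) := Ordinal (ltnW (proj1 (andP (hbounded 1%N ord0)))).
pose c4 := \int[P 1%N]_w (e 1%N ord0 j0 w ^+ 4).
(* the common law of all the errors makes their fourth moment a constant *)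
have e_mean4 k i j : \int[P k]_w (e k i j w ^+ 4) <= c4.
  rewrite le_eqVlt; apply/orP; left; apply/eqP.
  apply: (mean_identically_distributed (f := fun x => x ^+ 4)); first exact: hlaw.
    exact: exprn_measurable.
  by move=> x; rewrite exprn_even_ge0.
have n2 k i : (2 <= n k i)%N by case/andP: (hbounded k i).
have c40 : 0 <= c4 by apply: Rintegral_ge0 => w _; rewrite exprn_even_ge0.
move=> x _.
suff : (fun k => cdf (Jn mu (b k) (e k)) x) @ \oo --> (Phi x)%:E by rewrite PhiE.
apply: cvg_EFin.
  by apply: nearW => k; rewrite fin_num_measure.
have mS k : measurable_fun setT (leading (e k) se2) by exact: (measurable_leading (b k)).
have mJ k : measurable_fun setT (Jresponse mu (b k) (e k)) by exact: measurable_Jresponse.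
rewrite (_ : _ \o _ =
    fun k => fine (P k [set w | Jresponse mu (b k) (e k) w <= x])); last first.
  apply/funext => k /=.
  suff -> : [set w | Jresponse mu (b k) (e k) w <= x] =
    Jresponse mu (b k) (e k) @^-1` `]-oo, x] by [].
  by apply/seteqP; split => w /=; rewrite in_itv.
apply: (cvg_cdf_of_heat (S := fun k => leading (e k) se2)) => //.
- move=> y a a0; pose C := 2 * (1 + pair4 c4 N) * se2^-1 ^+ 3.
  have C0 : 0 <= C.
    by rewrite mulr_ge0 ?exprn_ge0 ?invr_ge0 ?(ltW s20)// mulr_ge0// addr_ge0// pair4_ge0.
  apply: (@cvg_of_rate _ _ _ (heat_bound a * (C + 1))) => k k2.
  have k0 := ltnW k2.
  have := leading_heat (indX k) k0 (hbounded k) s20 (@e_mean k) (@e_var k)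
    (@e_int4 k) (@e_mean4 k) y a0.
  move=> h; apply: le_trans h _; rewrite -[leRHS]mulrA ler_wpM2l ?heat_bound_ge0//.
  rewrite [leRHS]mulrDl mul1r lerD ?inv_vtot_rate//.
  by rewrite ler_wpM2l// inv_sqrt_vtot_rate.
- move=> eps eps0.
  have x1 : 0 < `|x| + 1 by rewrite ltr_wpDl.
  (* the relative precision required of W and of M *)
  pose q := Num.min (2^-1) (eps / (6 * (`|x| + 1))).
  have q0 : 0 < q by rewrite lt_min invr_gt0 ltr0n/= divr_gt0// mulr_gt0.
  have q2 : q <= 2^-1 by rewrite ge_min lexx.
  have xq : 3 * q * `|x| <= eps / 2.
    have : q * (`|x| + 1) <= eps / 6.
      rewrite -ler_pdivlMr// -mulrA -invfM ge_min lexx orbT//.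
    have := ltW q0; lra.
  exists (fun k => bad_event (b k) (e k) se2 q eps); split.
    pose C := (2 * c4 + 8 * se2 ^+ 2) / (q * se2) ^+ 2 +
      (1 + se2 ^+ 2 + se2) / (eps / 2 * se2).
    apply: (@cvg_of_rate _ _ _ C) => k k2; have k0 := ltnW k2.
    rewrite subr0 ger0_norm ?fine_ge0//.
    apply: le_trans (bad_event_le (indX k) k0 (hbounded k) s20 (@e_mean k)
      (@e_var k) (@e_int4 k) (@e_mean4 k) (@b_null k) q0 eps0) _.
    have s22 := sqr_ge0 se2.
    rewrite [leRHS]mulrDl lerD//.
      rewrite mulrAC ler_wpM2l ?inv_total_size_rate//.
      by rewrite divr_ge0 ?sqr_ge0//; lra.
    rewrite ler_wpM2l ?inv_sqrt_vtot_rate// divr_ge0 ?mulr_ge0 ?divr_ge0 ?ltW//.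
    lra.
  have q3 : 0 < q / 3 by rewrite divr_gt0.
  have /cvgrPdist_le /(_ _ q3) := @cvg_rate R.
  move=> h; near=> k; have k2 : (2 <= k)%N by near: k; exact: nbhs_infty_ge.
  have k0 := ltnW k2.
  have hk : `|0 - rate k| <= q / 3 by near: k; exact: h.
  split; first exact: (measurable_bad (indX k) k0 (hbounded k) (@e_mean k)
      (@e_var k) (@e_int4 k) (@e_mean4 k) (@b_null k)).
  apply: (bad_event_sandwich mu k0 (hbounded k) s20) => //.
  have := @inv_vtot_rate R k (n k) (n2 k) k2.
  by move: hk; rewrite sub0r normrN (ger0_norm (rate_ge0 k)); lra.
Unshelve. all: by end_near. Qed.
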